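(* Let $p\neq 2$ be a prime and let $\mathbf Z_p$ be the ring of $p$-adic integers. Let $\zeta^W_{SL_2(\mathbf Z_p)}(s)=\sum_{\rho}\deg(\rho)^{-s}$, the sum over equivalence classes of continuous irreducible complex representations $\rho$ of the profinite group $SL_2(\mathbf Z_p)$, continued meromorphically in $s$. Then $\zeta^W_{SL_2(\mathbf Z_p)}(s)=0$ for $s=-1$ and $s=-2$.
   Context: Continuous irreducible complex representations of the profinite group $SL_2(\mathbf Z_p)$ are finite-dimensional; $\deg(\rho)$ denotes the dimension. The Dirichlet series converges for $\Re(s)$ sufficiently large, and its values at $s=-1,-2$ refer to its meromorphic continuation. *)

(* Defs.v *)
From HB Require Import structures.
From mathcomp Require Import all_boot all_order all_algebra all_real_closed.
From mathcomp Require Import all_classical all_reals all_analysis.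
From mathcomp.analysis.showcase Require Import summability.

Set Implicit Arguments.
Unset Strict Implicit.
Unset Printing Implicit Defensive.

Import Order.TTheory GRing.Theory Num.Theory.
Import numFieldNormedType.Exports.

Local Open Scope classical_set_scope.
Local Open Scope ring_scope.

(* The ring of p-adic integers is the inverse limit of the rings Z/p^(n+1).
   Indexing by n.+1 is essential: 'Z_(p ^ 0) = 'Z_1 would denote Z/2. *)
Section PadicInt.
Variable p : nat.

Definition padic_red n (x : 'Z_(p ^ n.+2)) : 'Z_(p ^ n.+1) := inZp x.

Record padic_int := PadicInt {
  padic_val : forall n, 'Z_(p ^ n.+1);
  _ : `[< forall n, padic_red (padic_val n.+1) = padic_val n >]
}.

HB.instance Definition _ := [isSub for padic_val].
HB.instance Definition _ := [Choice of padic_int by <:].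

Lemma padic_valP (x : padic_int) n :
  padic_red (padic_val x n.+1) = padic_val x n.
Proof. by case: x => x /= /asboolP. Qed.

Lemma padic_ext (x y : padic_int) :
  (forall n, padic_val x n = padic_val y n) -> x = y.
Proof. by move=> xy; apply: val_inj => /=; apply: functional_extensionality_dep. Qed.

Lemma Zp_dvd n : ((Zp_trunc (p ^ n.+1)).+2 %| (Zp_trunc (p ^ n.+2)).+2)%N.
Proof.
case: p => [|[|q]]; first by rewrite !exp0n.
  by rewrite !exp1n.
have gt1 m : (1 < q.+2 ^ m.+1)%N.
  by rewrite (leq_trans _ (leq_pexp2l _ (ltn0Sn m))).
by rewrite !Zp_cast // dvdn_exp2l.
Qed.

Lemma padic_red0 n : padic_red (0 : 'Z_(p ^ n.+2)) = 0.
Proof. by apply: val_inj; rewrite /= mod0n. Qed.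

Lemma padic_red1 n : padic_red (1 : 'Z_(p ^ n.+2)) = 1.
Proof. by apply: val_inj; rewrite /= modn_dvdm ?Zp_dvd. Qed.

Lemma padic_redD n (x y : 'Z_(p ^ n.+2)) :
  padic_red (x + y) = padic_red x + padic_red y.
Proof. by apply: val_inj; rewrite /= modn_dvdm ?Zp_dvd // modnDm. Qed.

Lemma padic_redM n (x y : 'Z_(p ^ n.+2)) :
  padic_red (x * y) = padic_red x * padic_red y.
Proof. by apply: val_inj; rewrite /= modn_dvdm ?Zp_dvd // modnMm. Qed.

Lemma padic_redN n (x : 'Z_(p ^ n.+2)) : padic_red (- x) = - padic_red x.
Proof.
by apply/eqP; rewrite -subr_eq0 opprK -padic_redD addNr padic_red0.
Qed.

Definition padic_zero : padic_int.
Proof. by exists (fun=> 0); apply/asboolP => n; rewrite padic_red0. Defined.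

Definition padic_one : padic_int.
Proof. by exists (fun=> 1); apply/asboolP => n; rewrite padic_red1. Defined.

Definition padic_add (x y : padic_int) : padic_int.
Proof.
exists (fun n => padic_val x n + padic_val y n).
by apply/asboolP => n; rewrite padic_redD !padic_valP.
Defined.

Definition padic_opp (x : padic_int) : padic_int.
Proof.
exists (fun n => - padic_val x n).
by apply/asboolP => n; rewrite padic_redN !padic_valP.
Defined.

Definition padic_mul (x y : padic_int) : padic_int.
Proof.
exists (fun n => padic_val x n * padic_val y n).
by apply/asboolP => n; rewrite padic_redM !padic_valP.
Defined.

Lemma padic_addA : associative padic_add.
Proof. by move=> x y z; apply: padic_ext => n /=; rewrite addrA. Qed.
Lemma padic_addC : commutative padic_add.
Proof. by move=> x y; apply: padic_ext => n /=; rewrite addrC. Qed.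
Lemma padic_add0 : left_id padic_zero padic_add.
Proof. by move=> x; apply: padic_ext => n /=; rewrite add0r. Qed.
Lemma padic_addN : left_inverse padic_zero padic_opp padic_add.
Proof. by move=> x; apply: padic_ext => n /=; rewrite addNr. Qed.

HB.instance Definition _ := GRing.isZmodule.Build padic_int
  padic_addA padic_addC padic_add0 padic_addN.

Lemma padic_mulA : associative padic_mul.
Proof. by move=> x y z; apply: padic_ext => n /=; rewrite mulrA. Qed.
Lemma padic_mulC : commutative padic_mul.
Proof. by move=> x y; apply: padic_ext => n /=; rewrite mulrC. Qed.
Lemma padic_mul1 : left_id padic_one padic_mul.
Proof. by move=> x; apply: padic_ext => n /=; rewrite mul1r. Qed.
Lemma padic_mulDl : left_distributive padic_mul padic_add.
Proof. by move=> x y z; apply: padic_ext => n /=; rewrite mulrDl. Qed.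
Lemma padic_1_neq0 : padic_one != padic_zero.
Proof.
apply/eqP => /(congr1 (fun x => padic_val x 0)) /= /eqP.
by rewrite oner_eq0.
Qed.

HB.instance Definition _ := GRing.Zmodule_isComNzRing.Build padic_int
  padic_mulA padic_mulC padic_mul1 padic_mulDl padic_1_neq0.

(* The profinite topology: each Z/p^(n+1) is discrete. *)
HB.instance Definition _ := Topological.copy padic_int
  (initial_topology (padic_val :
     padic_int -> prod_topology (fun n => discrete_topology 'Z_(p ^ n.+1)))).

End PadicInt.

Section SL2.
Variable p : nat.

Record SL2Zp := MkSL2Zp {
  SL2_mx :> 'M[padic_int p]_2;
  _ : \det SL2_mx == 1
}.

HB.instance Definition _ := [isSub for SL2_mx].
HB.instance Definition _ := [Choice of SL2Zp by <:].

Lemma SL2_det (g : SL2Zp) : \det g = 1.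
Proof. by case: g => g /= /eqP. Qed.

Definition SL2_one : SL2Zp.
Proof. by exists 1%:M; rewrite det1. Defined.

Definition SL2_mul (g h : SL2Zp) : SL2Zp.
Proof. by exists (SL2_mx g *m SL2_mx h); rewrite det_mulmx !SL2_det mulr1. Defined.

Definition SL2_inv (g : SL2Zp) : SL2Zp.
Proof.
exists (\adj (SL2_mx g)); apply/eqP.
by rewrite -[LHS]mulr1 -(SL2_det g) -det_mulmx mul_adj_mx SL2_det det1.
Defined.

Lemma SL2_mulA : associative SL2_mul.
Proof. by move=> g h k; apply: val_inj; rewrite /= mulmxA. Qed.
Lemma SL2_mul1g : left_id SL2_one SL2_mul.
Proof. by move=> g; apply: val_inj; rewrite /= mul1mx. Qed.
Lemma SL2_mulg1 : right_id SL2_one SL2_mul.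
Proof. by move=> g; apply: val_inj; rewrite /= mulmx1. Qed.
Lemma SL2_mulVg : left_inverse SL2_one SL2_inv SL2_mul.
Proof. by move=> g; apply: val_inj; rewrite /= mul_adj_mx SL2_det. Qed.
Lemma SL2_mulgV : right_inverse SL2_one SL2_inv SL2_mul.
Proof. by move=> g; apply: val_inj; rewrite /= mul_mx_adj SL2_det. Qed.

HB.instance Definition _ := isGroup.Build SL2Zp
  SL2_mulA SL2_mul1g SL2_mulg1 SL2_mulVg SL2_mulgV.

HB.instance Definition _ := Topological.copy SL2Zp (initial_topology SL2_mx).

End SL2.

HB.instance Definition _ (R : realType) := NormedModule.copy R[i] R[i]^o.

Section Irrep.
Variables (R : realType) (p : nat).

(* As in mathcomp.character.mxrepresentation, matrices act on row vectors and
   a subspace is the row space of a square matrix U. *)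
Record irrep := Irrep {
  deg : nat;
  irrep_mx :> SL2Zp p -> 'M[R[i]]_deg;
  irrep_mx1 : irrep_mx 1%g = 1%:M;
  irrep_mxM : forall g h, irrep_mx (g * h)%g = irrep_mx g *m irrep_mx h;
  irrep_continuous : continuous irrep_mx;
  irrep_deg_gt0 : (0 < deg)%N;
  irrep_irreducible : forall U : 'M[R[i]]_deg,
    (forall g, stablemx U (irrep_mx g)) -> U != 0 -> row_full U
}.

HB.instance Definition _ := gen_eqMixin irrep.
HB.instance Definition _ := gen_choiceMixin irrep.

Definition irrep_sim (r1 r2 : irrep) : Prop :=
  exists B : 'M[R[i]]_(deg r1, deg r2),
    [/\ deg r1 = deg r2, row_free B & forall g, r1 g *m B = B *m r2 g].

Lemma irrep_sim_refl r : irrep_sim r r.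
Proof.
exists 1%:M; split=> //; first by rewrite row_free_unit unitmx1.
by move=> g; rewrite mulmx1 mul1mx.
Qed.

Lemma irrep_sim_sym r1 r2 : irrep_sim r1 r2 -> irrep_sim r2 r1.
Proof.
case: r1 r2 => [n1 r1 ? ? ? ? ?] [n2 r2 ? ? ? ? ?] [/= B [/= def_n1]].
subst n2; rewrite row_free_unit => injB homB; exists (invmx B).
split=> //= [|g]; first by rewrite row_free_unit unitmx_inv.
by apply: canRL (mulKmx injB) _; rewrite mulmxA -homB ?mulmxK.
Qed.

Lemma irrep_sim_trans r1 r2 r3 :
  irrep_sim r1 r2 -> irrep_sim r2 r3 -> irrep_sim r1 r3.
Proof.
case=> [B1 [defn1 freeB1 homB1]] [B2 [defn2 freeB2 homB2]].
exists (B1 *m B2); split; first by rewrite defn1.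
  by rewrite /row_free mxrankMfree.
by move=> g; rewrite mulmxA homB1 // -!mulmxA homB2.
Qed.

Definition irrep_simb : rel irrep := fun r1 r2 => `[< irrep_sim r1 r2 >].

Lemma irrep_simb_refl : reflexive irrep_simb.
Proof. by move=> r; apply/asboolP/irrep_sim_refl. Qed.
Lemma irrep_simb_sym : symmetric irrep_simb.
Proof. by move=> r1 r2; apply/asboolP/asboolP; apply: irrep_sim_sym. Qed.
Lemma irrep_simb_trans : transitive irrep_simb.
Proof.
by move=> r2 r1 r3 /asboolP r12 /asboolP r23; apply/asboolP/(irrep_sim_trans r12).
Qed.

Canonical irrep_equiv :=
  EquivRel irrep_simb irrep_simb_refl irrep_simb_sym irrep_simb_trans.

Definition irrep_class : Type := {eq_quot irrep_equiv}%qT.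
HB.instance Definition _ := Choice.on irrep_class.

Definition class_deg (c : irrep_class) : nat := deg (repr c).

End Irrep.

Section ComplexAnalysis.
Variable R : realType.
Implicit Types (f : R[i] -> R[i]) (s z : R[i]).

Definition expC z : R[i] :=
  Complex (expR (complex.Re z) * cos (complex.Im z))
          (expR (complex.Re z) * sin (complex.Im z)).

(* The term n^(-s) of a Dirichlet series, for n > 0. *)
Definition dirichlet_term (n : nat) s : R[i] :=
  expC (- (s * Complex (ln (n%:R : R)) 0)).

Definition holomorphic_at f z := \forall w \near z, derivable f w 1.

Definition meromorphic_at f z := exists (k : nat) (g : R[i] -> R[i]),
  holomorphic_at g z /\ \forall w \near z^', f w = g w / (w - z) ^+ k.

Definition meromorphic f := forall z, meromorphic_at f z.

(* F is a meromorphic continuation to the complex plane of the sum of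
   deg(rho)^(-s) over the classes of irreducible representations; the sum is
   the limit of the net of finite partial sums.  A meromorphic F is constrained
   only off a discrete set, so its value at z is meaningful where
   [holomorphic_at F z] holds, and there it does not depend on the choice of F. *)
Definition witten_zeta_continuation (p : nat) (F : R[i] -> R[i]) :=
  meromorphic F /\
  exists sigma : R, forall s, sigma < complex.Re s ->
    partial_sum (fun c : irrep_class R p => dirichlet_term (class_deg c) s)
      @ totally --> F s.

End ComplexAnalysis.

(* Main.v *)
(* Let U be the group of upper unitriangular matrices.  The anti-automorphism
   g |-> P g^-1 P^-1, P = diag(1, -1), fixes U pointwise, and it follows that a
   primitive character of U has multiplicity at most 1 in every irreducible
   representation of SL2(Z/p^(n+1)).  For n > 0 let such a representation be new,
   i.e. nontrivial on the kernel of reduction mod p^n.  This kernel is sl2(F_p), on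
   which the characters that occur form one orbit O of G_0 = SL2(F_p); comparing the
   multiplicities of these characters and of those of U shows that the degree is
   p^(n-1) |O|.  As the sum of deg^2 over the new representations above O is
   determined by |O|, there are p^(n-1) |G_0| / |O| of them, and
     zeta(s) = A(s) + B(s) / (1 - p^(1 - s)),
   where A is the zeta function of G_0 and
   B(s) = sum_O |G_0| |O|^(-1) |O|^(-s).
   At s = -2 one has A = |G_0| and B = |G_0| (p^3 - 1).  At s = -1, B = |G_0| #{O},
   where the number of nonzero orbits comes from Burnside's lemma, and A, the sum of
   the degrees of G_0, is the number p^2 + p of fixed points of the anti-automorphism
   by a twisted Frobenius-Schur count: every irreducible representation of G_0 is
   isomorphic to its twisted dual through a symmetric form. *)

Require Import Defs.
From HB Require Import structures.
From mathcomp Require Import all_boot all_order all_algebra all_fingroup.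
From mathcomp Require Import all_solvable all_field all_character.
From mathcomp Require Import all_real_closed ring finmap.
From mathcomp Require Import all_classical all_reals all_analysis.
From mathcomp.analysis.showcase Require Import summability.

Set Implicit Arguments.
Unset Strict Implicit.
Unset Printing Implicit Defensive.

Import Order.TTheory GRing.Theory Num.Theory.
Import poly.UnityRootTheory.
Import numFieldNormedType.Exports.

Local Open Scope ring_scope.

(** * Averaging over finite groups *)

(** The comparison of multiplicities runs as follows. The characters of the kernel are matrices Y of
    trace zero, and on the elements of U in the kernel such a character only remembers the lower
    left entry z of Y. For z nonzero, O contains exactly p matrices with this entry: the diagonal
    entry is free and the determinant fixes the rest. Conjugacy gives them one common multiplicity
    m. On the side of U, p^n characters lie above z, all conjugate under the diagonal torus because
    every unit congruent to 1 is a square, so they share a multiplicity e <= 1. Hence p m = p^n e,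
    and m = p^(n-1). Here p must be odd, as it must for the trace form to be nondegenerate. The
    symmetric form of the Frobenius-Schur count appears as a projection of rank one whose
    coefficients are invariant under the anti-automorphism. Both zeros are cancellations against 1 -
    q with q = p^(1-s). At s = -2 the partial sums are the orders |G_0| p^(3n), a geometric
    progression without constant term. At s = -1 there are p + 1 nonzero orbits, so that B = (p^2 -
    1)(p^2 + p) while q = p^2. *)

Lemma idempotent_base (F : fieldType) d (E : 'M[F]_d) :
  E *m E = E -> row_base E *m col_base E = 1%:M.
Proof.
move=> EE; have fr := row_base_free E; have fc := col_base_full E.
have := mulmx_base E; move: (row_base E) (col_base E) fr fc => r c fr fc crE.
apply: (row_free_inj fr); apply: (row_full_inj fc).
by rewrite /= mul1mx crE !mulmxA crE -mulmxA crE.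
Qed.

Lemma idempotent_mxtrace (F : fieldType) d (E : 'M[F]_d) :
  E *m E = E -> \tr E = (\rank E)%:R.
Proof.
move=> EE; rewrite -{1}(mulmx_base E) mxtrace_mulC.
by rewrite idempotent_base // mxtrace1.
Qed.

(* [E 'M_d E] is isomorphic to the algebra of matrices of size [\rank E]. *)
Lemma commutative_corner_rank (F : fieldType) d (E : 'M[F]_d) :
  E *m E = E ->
  (forall X Y, E *m X *m E *m Y *m E = E *m Y *m E *m X *m E) ->
  (\rank E <= 1)%N.
Proof.
move=> EE comE; rewrite leqNgt; apply/negP => r2.
have := idempotent_base EE; have := mulmx_base E.
have := row_base_free E; have := col_base_full E.
move: (\rank E) (row_base E) (col_base E) r2 => k r c k2 fc fr crE rc.
pose lift Z := c *m Z *m r.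
have EL Z : E *m lift Z = lift Z.
  by rewrite -crE /lift !mulmxA -(mulmxA c r c) rc mulmx1.
have LE Z : lift Z *m E = lift Z.
  by rewrite -crE /lift -!mulmxA (mulmxA r c r) rc mul1mx.
have LL Z Z' : lift Z *m lift Z' = lift (Z *m Z').
  by rewrite /lift !mulmxA -(mulmxA _ r c) rc mulmx1.
(* In rank at least 2 the matrix units of positions (0,1) and (1,0) would have to commute. *)
have /matrixP /(_ (Ordinal (ltnW k2)) (Ordinal (ltnW k2))) :
    delta_mx (Ordinal (ltnW k2)) (Ordinal k2) *m delta_mx (Ordinal k2) (Ordinal (ltnW k2))
    = delta_mx (Ordinal k2) (Ordinal (ltnW k2)) *m delta_mx (Ordinal (ltnW k2)) (Ordinal k2)
    :> 'M[F]_k.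
  apply: (row_full_inj fc); apply: (row_free_inj fr) => /=.
  have := comE (lift (delta_mx (Ordinal (ltnW k2)) (Ordinal k2)))
               (lift (delta_mx (Ordinal k2) (Ordinal (ltnW k2)))).
  by rewrite !(EL, LE) !LL !LE /lift.
by rewrite !mul_delta_mx !mxE eqxx /= => /eqP; rewrite oner_eq0.
Qed.

Section FiniteGroupReps.
Variables (C : numClosedFieldType) (gT : finGroupType) (G : {group gT}).

Lemma pchar_numG : pgroup.pgroup [pchar C]^' G.
Proof. by apply/andP; split; rewrite ?cardG_gt0 //; apply/allP => q _; rewrite inE /= pchar_num. Qed.

(** A non-scalar matrix of the commutant, minus one of its eigenvalues, is a nonzero singular
    intertwiner, against Schur's lemma. *)
Lemma closed_group_splitting : group_splitting_field C G.
Proof.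
move=> [|n] rG irrG; first by case/mx_irrP: irrG.
apply: cent_mx_scalar_abs_irr => //; rewrite leqNgt.
apply/(has_non_scalar_mxP (scalar_mx_cent _ _)) => [[A cGA nscalA]].
have [a /eigenvalueP[v vA nzv]] := eigenvalue_closed A (ltn0Sn n).
have cGAa : centgmx rG (A - a%:M).
  have cGA' : centgmx rG A by rewrite -memmx_cent_envelop.
  apply/centgmxP => g Gg; rewrite mulmxBl mulmxBr scalar_mxC.
  by rewrite (centgmxP cGA').
have [A0|nzA] := eqVneq (A - a%:M) 0.
  by case/negP: nscalA; apply/is_scalar_mxP; exists a; apply/eqP; rewrite -subr_eq0 A0.
have := mx_Schur irrG cGAa nzA; rewrite -row_free_unit -kermx_eq0 => /eqP k0.
have : (v <= kermx (A - a%:M))%MS.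
  by apply/sub_kermxP; rewrite mulmxBr vA mul_mx_scalar subrr.
by rewrite k0 submx0 (negPf nzv).
Qed.

Section OneIrr.
Variables (d : nat) (r : mx_representation C G d).
Hypothesis irr : mx_irreducible r.

Lemma irr_dim_gt0 : (0 < d)%N. Proof. by case/mx_irrP: irr. Qed.

Lemma irr_dim_neq0 : d%:R != 0 :> C.
Proof. by rewrite pnatr_eq0 -lt0n irr_dim_gt0. Qed.

Lemma irr_cent_scalar (A : 'M[C]_d) :
  (forall g, g \in G -> A *m r g = r g *m A) -> A = (\tr A / d%:R)%:M.
Proof.
move=> cA; have /is_scalar_mxP[a ->] : is_scalar_mx A.
  apply: (mx_abs_irr_cent_scalar (closed_group_splitting irr)).
  exact/centgmxP.
by rewrite mxtrace_scalar -[a *+ d]mulr_natr mulfK ?irr_dim_neq0.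
Qed.

(** Burnside's theorem: the enveloping algebra of an absolutely irreducible representation is the
    full matrix algebra. *)
Lemma irr_span (A : 'M[C]_d) : exists a : gT -> C, A = \sum_(g in G) a g *: r g.
Proof.
have /mx_abs_irrP[_ [a aE]] := closed_group_splitting irr.
by exists (a^~ A).
Qed.

(** The average commutes with the representation, hence is scalar, and conjugation keeps the trace,
    which determines the scalar. *)
Lemma schur_average (X : 'M[C]_d) :
  \sum_(g in G) r g *m X *m r g^-1%g = (#|G|%:R * \tr X / d%:R)%:M.
Proof.
rewrite [LHS]irr_cent_scalar => [|h Gh]; last first.
  rewrite mulmx_suml mulmx_sumr [RHS](reindex_inj (mulgI h^-1)%g) /=.
  apply: eq_big => [g|g Gg]; first by rewrite groupMl ?groupV.
  rewrite invMg invgK -!mulmxA -repr_mxM ?groupV // !mulmxA -repr_mxM ?groupM ?groupV //.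
  by rewrite mulgA mulgV mul1g.
congr (_ / _)%:M; rewrite raddf_sum /= (eq_bigr (fun=> \tr X)) => [|g Gg].
  by rewrite sumr_const mulr_natl.
by rewrite mxtrace_mulC mulmxA -repr_mxM ?groupV // mulVg repr_mx1 mul1mx.
Qed.

Lemma irr_central_idempotent (M : 'M[C]_d) :
  (forall g, g \in G -> M *m r g = r g *m M) -> M *m M = M -> M = 0 \/ M = 1%:M.
Proof.
move=> /irr_cent_scalar -> ; set a := _ / _ => /eqP.
rewrite -scalar_mxM -subr_eq0 -raddfB /= => /eqP/matrixP aa.
have := aa (Ordinal irr_dim_gt0) (Ordinal irr_dim_gt0).
rewrite !mxE eqxx !mulr1n => /eqP.
rewrite -[X in _ - X]mulr1 -mulrBr mulf_eq0 subr_eq0 => /orP[]/eqP->; last by right.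
by left; rewrite raddf0.
Qed.

End OneIrr.

Variable sG : irrType C G.

(** Both sides are the character of the regular representation: decomposed into irreducibles, and
    read off its permutation matrices. *)
Lemma sum_irr_trace g : g \in G ->
  \sum_(i : sG) (irr_degree i)%:R * \tr (irr_repr i g) = #|G|%:R * (g == 1%g)%:R.
Proof.
move=> Gg; under eq_bigr do rewrite mulr_natl.
rewrite -(mxtrace_regular_pchar sG pchar_numG closed_group_splitting Gg).
rewrite /mxtrace; have [->|g1] := eqVneq g 1%g.
  under eq_bigr do rewrite repr_mx1 mxE eqxx.
  by rewrite sumr_const card_ord mulr1.
rewrite mulr0 big1 // => i _; rewrite /= !mxE eqxx /=.
have [/eqP|//] := eqVneq; rewrite eq_sym -(inj_eq enum_val_inj).
rewrite gring_indexK ?groupM ?enum_valP // -[X in _ == X]mulg1.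
by rewrite (inj_eq (mulgI _)) (negPf g1).
Qed.

End FiniteGroupReps.

Section FullGroup.
Variables (C : numClosedFieldType) (gT : finGroupType).
Local Notation G := [set: gT]%G.
Variables (d : nat) (r : mx_representation C G d).

Lemma repr_mulT g h : r (g * h)%g = r g *m r h.
Proof. by rewrite repr_mxM ?inE. Qed.

Hypothesis irr : mx_irreducible r.

Lemma schur_averageT (X : 'M[C]_d) :
  \sum_g r g *m X *m r g^-1%g = (#|gT|%:R * \tr X / d%:R)%:M.
Proof.
rewrite -cardsT -(schur_average irr).
by apply: eq_bigl => g; rewrite inE.
Qed.

(** * The twisted Frobenius-Schur count *)

Section TwistedFrobeniusSchur.
Variables (tau : gT -> gT) (E : 'M[C]_d).
Hypothesis tauM : forall g h, tau (g * h)%g = (tau h * tau g)%g.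
Hypothesis tauK : involutive tau.
Hypothesis E1 : E *m E = E.
Hypothesis rankE : \rank E = 1%N.
Hypothesis tauE : forall g, E *m r (tau g) *m E = E *m r g *m E.

(** Writing E = u v with a column u and a row v, this is the matrix coefficient v r(g) u. Its
    invariance under [tau], shown in [phi_tau], replaces the symmetric form between the
    representation and its twisted dual. *)
Let phi g := \tr (E *m r g).

Lemma corner_coef X : E *m X *m E = \tr (E *m X) *: E.
Proof.
have := mulmx_base E.
move: (\rank E) rankE (row_base E) (col_base E) => _ -> v u <-.
have -> : u *m v *m X *m (u *m v) = u *m (v *m X *m u) *m v by rewrite !mulmxA.
rewrite -[X in \tr X]mulmxA mxtrace_mulC [v *m X *m u]mx11_scalar.
by rewrite mxtrace_scalar mulr1n mul_mx_scalar -scalemxAl.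
Qed.

Let phi_tau g : phi (tau g) = phi g.
Proof.
have trE1 X : \tr (E *m X) = \tr (E *m X *m E).
  by rewrite [RHS]mxtrace_mulC mulmxA E1.
by rewrite /phi trE1 tauE -trE1.
Qed.

Let trE : \tr E = 1. Proof. by rewrite idempotent_mxtrace // rankE. Qed.

Let phi1 : phi 1%g = 1.
Proof. by rewrite /phi repr_mx1 mulmx1 trE. Qed.

Let d0 : d%:R != 0 :> C := irr_dim_neq0 irr.
Let G0 : #|gT|%:R != 0 :> C.
Proof. by rewrite pnatr_eq0 -cardsT -lt0n cardG_gt0. Qed.

Let trace_phi h : \tr (r h) = d%:R / #|gT|%:R * \sum_x phi (x * h * x^-1)%g.
Proof.
rewrite (eq_bigr (fun x => \tr (E *m (r x *m r h *m r x^-1%g)))) => [|x _].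
  rewrite -raddf_sum /= -mulmx_sumr schur_averageT mul_mx_scalar mxtraceZ.
  by rewrite trE; field; apply/andP.
by rewrite /phi !repr_mulT.
Qed.

Let phi_conv a b :
  \sum_z phi (a * z)%g * phi (z^-1 * b)%g = #|gT|%:R / d%:R * phi (a * b)%g.
Proof.
rewrite (eq_bigr (fun z => \tr (E *m r a *m (r z *m E *m r z^-1%g) *m r b))) => [|z _].
  rewrite -raddf_sum /= -mulmx_suml -mulmx_sumr schur_averageT.
  rewrite trE mulr1 mul_mx_scalar -scalemxAl mxtraceZ.
  by rewrite -mulmxA -repr_mulT.
rewrite /phi !repr_mulT !mulmxA -[E *m r a *m r z]mulmxA corner_coef.
by rewrite -!scalemxAl mxtraceZ !mulmxA.
Qed.

Let phi_orth a b c :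
  \sum_y phi (a * y * b)%g * phi (c * y^-1)%g
    = #|gT|%:R / d%:R * (phi (c * b)%g * phi a).
Proof.
rewrite (eq_bigr (fun y => \tr (E *m r a *m (r y *m (r b *m E *m r c) *m r y^-1%g)))).
  rewrite -raddf_sum /= -mulmx_sumr schur_averageT mul_mx_scalar mxtraceZ.
  rewrite -mulmxA mxtrace_mulC -mulmxA -repr_mulT; rewrite -/(phi _) -/(phi _); ring.
move=> y _; rewrite /phi !repr_mulT !mulmxA.
rewrite -[E *m r a *m r y *m r b]mulmxA -[E *m r a *m _]mulmxA corner_coef.
by rewrite -!scalemxAl mxtraceZ !mulmxA.
Qed.

(** Each trace is an average of [phi] over conjugates. Expanding by the convolution formula and
    applying [tau] to one factor, the orthogonality relation removes all variables but one, and what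
    remains is the convolution square of [phi] at 1. *)
Lemma twisted_frobenius_schur :
  \sum_w \tr (r (tau w * w^-1)%g) = #|gT|%:R.
Proof.
have tau1 : tau 1%g = 1%g by apply: (mulgI (tau 1%g)); rewrite -tauM !mulg1.
have tauV g : tau g^-1%g = (tau g)^-1%g.
  by apply: (mulgI (tau g)); rewrite -tauM mulVg mulgV tau1.
have key x : \sum_w phi (x * (tau w * w^-1) * x^-1)%g = \sum_z phi z * phi z^-1%g.
  rewrite (reindex_inj (mulgI x^-1)%g) /=.
  transitivity (d%:R / #|gT|%:R * \sum_y \sum_z
      phi (tau z * y * tau x)%g * phi (z^-1 * (tau x)^-1 * y^-1)%g).
    rewrite mulr_sumr; apply: eq_bigr => y _.
    have -> : (x * (tau (x^-1 * y) * (x^-1 * y)^-1) * x^-1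
               = (x * tau y) * ((tau x)^-1 * y^-1))%g.
      by rewrite tauM tauV invMg invgK !mulgA mulgK.
    transitivity (d%:R / #|gT|%:R * (#|gT|%:R / d%:R
        * phi (x * tau y * ((tau x)^-1 * y^-1))%g)).
      by field; apply/andP.
    rewrite -phi_conv; congr (_ * _); apply: eq_bigr => z _.
    (* Applying [tau] turns [tau y] into [y], and the sum over [y] takes the form required by
       [phi_orth]. *)
    by rewrite -(phi_tau (x * tau y * z)%g) !tauM tauK !mulgA.
  rewrite exchange_big mulr_sumr /=; apply: eq_bigr => z _.
  rewrite phi_orth mulgKV phi_tau; field; exact/andP.
rewrite (eq_bigr (fun w => d%:R / #|gT|%:R
    * \sum_x phi (x * (tau w * w^-1) * x^-1)%g)) => [|w _]; last exact: trace_phi.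
rewrite -mulr_sumr exchange_big (eq_bigr _ (fun x _ => key x)) sumr_const.
have := phi_conv 1%g 1%g; rewrite mulg1 phi1 mulr1.
under eq_bigr do rewrite mul1g mulg1.
by move=> ->; rewrite -[_ *+ _]mulr_natr; field; apply/andP.
Qed.

End TwistedFrobeniusSchur.
End FullGroup.

(** * Fourier projections *)

(** Such a pairing identifies V with its character group, so characters of V can be indexed by V
    itself. *)
Record perfect_pairing (C : numClosedFieldType) (V : finZmodType)
    (beta : V -> V -> C) : Prop := PerfectPairing {
  pairC : forall x y, beta x y = beta y x;
  pairDr : forall y x x', beta y (x + x') = beta y x * beta y x';
  pair0r : forall y, beta y 0 = 1;
  pair_nondeg : forall y, (forall x, beta y x = 1) -> y = 0
}.

(** The projection onto the isotypic part of [r] for the character [beta y]. The lock keeps the sum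
    from being unfolded by conversion. *)
Definition fourier_proj (C : numClosedFieldType) (V : finZmodType)
    (beta : V -> V -> C) d (r : V -> 'M[C]_d) y : 'M[C]_d :=
  locked (#|V|%:R^-1 *: \sum_x beta y (- x) *: r x).

Lemma fourier_projE (C : numClosedFieldType) (V : finZmodType)
    (beta : V -> V -> C) d (r : V -> 'M[C]_d) y :
  fourier_proj beta r y = #|V|%:R^-1 *: \sum_x beta y (- x) *: r x.
Proof. by rewrite /fourier_proj -lock. Qed.

Section Fourier.
Variables (C : numClosedFieldType) (V : finZmodType) (beta : V -> V -> C).
Hypothesis pp : perfect_pairing beta.

Lemma card_finZmod_neq0 : #|V|%:R != 0 :> C.
Proof. by rewrite pnatr_eq0 -lt0n; apply/card_gt0P; exists 0. Qed.

Lemma pairDl y y' x : beta (y + y') x = beta y x * beta y' x.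
Proof. by rewrite !(pairC pp _ x) (pairDr pp). Qed.

Lemma pair0l x : beta 0 x = 1.
Proof. by rewrite (pairC pp) (pair0r pp). Qed.

Lemma pairNr y x : beta y (- x) * beta y x = 1.
Proof. by rewrite -(pairDr pp) addNr (pair0r pp). Qed.

Lemma pairNN y x : beta (- y) x = beta y (- x).
Proof.
have nz : beta y x != 0.
  by apply: contra_eq_neq (pairNr y x) => ->; rewrite mulr0 eq_sym oner_eq0.
apply: (mulIf nz); rewrite pairNr -pairDl addNr; exact: pair0l.
Qed.

Lemma sum_pair y : \sum_x beta y x = #|V|%:R * (y == 0)%:R.
Proof.
have [->|y0] := eqVneq y 0.
  by rewrite (eq_bigr _ (fun x _ => pair0l x)) sumr_const mulr1.
have [x0 bx0] : exists x, beta y x != 1.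
  apply/existsP; apply: contraNT y0; rewrite negb_exists => /forallP b1.
  by apply/eqP/(pair_nondeg pp) => x; apply/eqP; rewrite -[_ == _]negbK b1.
rewrite mulr0; apply/eqP; have : (beta y x0 - 1) * \sum_x beta y x = 0.
  rewrite mulrBl mul1r mulr_sumr [X in _ - X](reindex_inj (addrI x0)) /=.
  by rewrite -sumrB big1 // => x _; rewrite (pairDr pp) subrr.
by move/eqP; rewrite mulf_eq0 subr_eq0 (negPf bx0).
Qed.

Section Projections.
Variables (d : nat) (r : V -> 'M[C]_d).
Hypothesis r0 : r 0 = 1%:M.
Hypothesis rD : forall x x', r (x + x') = r x *m r x'.
Local Notation E := (fourier_proj beta r).

Lemma fourier_mull y x : r x *m E y = beta y x *: E y.
Proof.
rewrite !fourier_projE -scalemxAr mulmx_sumr !scalerA [_ * _^-1]mulrC -scalerA.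
congr (_ *: _); rewrite scaler_sumr [RHS](reindex_inj (addrI x)) /=.
apply: eq_bigr => x' _; rewrite rD -scalemxAr scalerA; congr (_ *: _).
by rewrite opprD (pairDr pp) mulrA [beta y x * _]mulrC pairNr mul1r.
Qed.

Lemma fourier_comm y x : E y *m r x = r x *m E y.
Proof.
rewrite !fourier_projE -scalemxAl -scalemxAr mulmx_suml mulmx_sumr.
by congr (_ *: _); apply: eq_bigr => x' _; rewrite -scalemxAl -scalemxAr -!rD addrC.
Qed.

Lemma fourier_mulr y x : E y *m r x = beta y x *: E y.
Proof. by rewrite fourier_comm fourier_mull. Qed.

Lemma fourier_orth y y' : E y *m E y' = (y == y')%:R *: E y.
Proof.
rewrite {1}fourier_projE -scalemxAl mulmx_suml.
under eq_bigr => x _ do rewrite -scalemxAl fourier_mull scalerA -pairNN -pairDl.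
rewrite -scaler_suml sum_pair addrC subr_eq0 scalerA mulrA.
rewrite mulVf ?card_finZmod_neq0 // mul1r eq_sym.
by case: eqP => [->|]; rewrite ?scale0r.
Qed.

Lemma fourier_idem y : E y *m E y = E y.
Proof. by rewrite fourier_orth eqxx scale1r. Qed.

Lemma fourier_expand x : r x = \sum_y beta y x *: E y.
Proof.
under eq_bigr do rewrite fourier_projE scalerA mulrC -scalerA scaler_sumr.
rewrite -scaler_sumr exchange_big (bigD1 x) //= [X in _ + X]big1 ?addr0.
  under eq_bigr do rewrite scalerA mulrC pairNr scale1r.
  rewrite sumr_const -[X in _ *: X]scaler_nat scalerA.
  by rewrite mulVf ?card_finZmod_neq0 // scale1r.
move=> x' nx; under eq_bigr do rewrite scalerA -(pairDr pp) (pairC pp).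
by rewrite -scaler_suml sum_pair subr_eq0 eq_sym (negPf nx) mulr0 scale0r.
Qed.

Lemma fourier_sum : \sum_y E y = 1%:M.
Proof.
rewrite -r0 fourier_expand; apply: eq_bigr => y _.
by rewrite (pair0r pp) scale1r.
Qed.

Lemma fourier_trivial : E 0 = 1%:M -> forall x, r x = 1%:M.
Proof. by move=> E1 x; rewrite -[LHS]mulmx1 -E1 fourier_mull pair0l scale1r. Qed.

(** An operator that normalises the image of V permutes the isotypic projections; [psi] is the
    adjoint of [phi] for the pairing. It serves both the torus acting on U and the group acting on
    the congruence kernel. *)
Lemma fourier_conj (phi psi : V -> V) (A : 'M[C]_d) y :
  injective phi -> {morph phi : x / - x} ->
  (forall x, A *m r x = r (phi x) *m A) ->
  (forall x, beta (psi y) x = beta y (phi x)) ->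
  A *m E (psi y) = E y *m A.
Proof.
move=> inj phiN rA bA; rewrite !fourier_projE -scalemxAl -scalemxAr.
congr (_ *: _); rewrite mulmx_suml mulmx_sumr [RHS](reindex_inj inj) /=.
apply: eq_bigr => x _; rewrite -scalemxAl -scalemxAr rA; congr (_ *: _).
by rewrite bA phiN.
Qed.

End Projections.
End Fourier.

(** The map [k] is dual to [h]: it sends a character of V to its restriction along [h]. The isotypic
    part of a character of W collects those of all characters of V that restrict to it. *)
Lemma fourier_restrict (C : numClosedFieldType) (V W : finZmodType)
    (beta : V -> V -> C) (gamma : W -> W -> C)
    (ppV : perfect_pairing beta) (ppW : perfect_pairing gamma)
    d (r : V -> 'M[C]_d) (r0 : r 0 = 1%:M)
    (rD : forall x x', r (x + x') = r x *m r x')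
    (h : W -> V) (k : V -> W) w :
  (forall y x, beta y (h x) = gamma (k y) x) ->
  fourier_proj gamma (r \o h) w = \sum_(y | k y == w) fourier_proj beta r y.
Proof.
move=> hk; rewrite fourier_projE.
under eq_bigr => x _ do
  rewrite /= (fourier_expand ppV r) scaler_sumr.
rewrite exchange_big scaler_sumr [RHS]big_mkcond /=; apply: eq_bigr => y _.
under eq_bigr => x _ do rewrite hk scalerA -(pairNN ppW) -(pairDl ppW).
rewrite -scaler_suml (sum_pair ppW) scalerA mulrA.
rewrite mulVf ?card_finZmod_neq0 // mul1r addrC subr_eq0.
by case: eqP => _; rewrite ?scale1r ?scale0r.
Qed.

(** * SL2 over a finite commutative ring *)

Section SpecialLinear.
Variable R : finComNzRingType.

(** Quadruples in place of matrices turn group identities into identities of entries within reach of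
    [ring]. *)
Record sl2 := Sl2 {
  sl2_val : R * R * R * R;
  _ : sl2_val.1.1.1 * sl2_val.2 - sl2_val.1.1.2 * sl2_val.1.2 == 1
}.

HB.instance Definition _ := [isSub for sl2_val].
HB.instance Definition _ := [Finite of sl2 by <:].

Definition e11 (g : sl2) := (sl2_val g).1.1.1.
Definition e12 (g : sl2) := (sl2_val g).1.1.2.
Definition e21 (g : sl2) := (sl2_val g).1.2.
Definition e22 (g : sl2) := (sl2_val g).2.

Lemma sl2_det g : e11 g * e22 g - e12 g * e21 g = 1.
Proof. by apply/eqP; case: g. Qed.

Definition mk2 a b c d (H : a * d - b * c = 1) : sl2 :=
  @Sl2 (a, b, c, d) (introT eqP H).

Lemma sl2_eq g h :
  e11 g = e11 h -> e12 g = e12 h -> e21 g = e21 h -> e22 g = e22 h -> g = h.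
Proof.
move=> H1 H2 H3 H4; apply: val_inj; move: H1 H2 H3 H4; rewrite /e11 /e12 /e21 /e22.
by case: g h => [[[[a b] c] d] ?] [[[[a' b'] c'] d'] ?] /= -> -> -> ->.
Qed.

Fact sl2_mul_proof g h :
  (e11 g * e11 h + e12 g * e21 h) * (e21 g * e12 h + e22 g * e22 h)
  - (e11 g * e12 h + e12 g * e22 h) * (e21 g * e11 h + e22 g * e21 h) = 1.
Proof.
transitivity ((e11 g * e22 g - e12 g * e21 g) * (e11 h * e22 h - e12 h * e21 h)).
  by ring.
by rewrite !sl2_det mulr1.
Qed.

Definition sl2_mul g h : sl2 := mk2 (sl2_mul_proof g h).

Fact sl2_one_proof : 1 * 1 - 0 * 0 = 1 :> R. Proof. by ring. Qed.
Definition sl2_one := mk2 sl2_one_proof.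

Fact sl2_inv_proof g : e22 g * e11 g - (- e12 g) * (- e21 g) = 1.
Proof. by rewrite -(sl2_det g); ring. Qed.
Definition sl2_inv g : sl2 := mk2 (sl2_inv_proof g).

Let mul11 g h : e11 (sl2_mul g h) = e11 g * e11 h + e12 g * e21 h. Proof. by []. Qed.
Let mul12 g h : e12 (sl2_mul g h) = e11 g * e12 h + e12 g * e22 h. Proof. by []. Qed.
Let mul21 g h : e21 (sl2_mul g h) = e21 g * e11 h + e22 g * e21 h. Proof. by []. Qed.
Let mul22 g h : e22 (sl2_mul g h) = e21 g * e12 h + e22 g * e22 h. Proof. by []. Qed.

Fact sl2_mulA : associative sl2_mul.
Proof. by move=> f g h; apply: sl2_eq; rewrite !(mul11, mul12, mul21, mul22); ring. Qed.
Fact sl2_mul1 : left_id sl2_one sl2_mul.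
Proof.
by move=> g; apply: sl2_eq; rewrite !(mul11, mul12, mul21, mul22) ?mul1r ?mul0r ?addr0 ?add0r.
Qed.
Fact sl2_mulV : left_inverse sl2_one sl2_inv sl2_mul.
Proof.
move=> g; apply: sl2_eq; rewrite !(mul11, mul12, mul21, mul22).
- by rewrite -[RHS](sl2_det g) mulNr mulrC.
- by rewrite mulNr mulrC subrr.
- by rewrite mulNr mulrC addNr.
- by rewrite -[RHS](sl2_det g) mulNr addrC mulrC [e21 g * _]mulrC.
Qed.

HB.instance Definition _ := Finite_isGroup.Build sl2 sl2_mulA sl2_mul1 sl2_mulV.

Lemma e11M g h : e11 (g * h)%g = e11 g * e11 h + e12 g * e21 h. Proof. by []. Qed.
Lemma e12M g h : e12 (g * h)%g = e11 g * e12 h + e12 g * e22 h. Proof. by []. Qed.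
Lemma e21M g h : e21 (g * h)%g = e21 g * e11 h + e22 g * e21 h. Proof. by []. Qed.
Lemma e22M g h : e22 (g * h)%g = e21 g * e12 h + e22 g * e22 h. Proof. by []. Qed.
Lemma e11V g : e11 g^-1%g = e22 g. Proof. by []. Qed.
Lemma e12V g : e12 g^-1%g = - e12 g. Proof. by []. Qed.
Lemma e21V g : e21 g^-1%g = - e21 g. Proof. by []. Qed.
Lemma e22V g : e22 g^-1%g = e11 g. Proof. by []. Qed.
Lemma e11_1 : e11 1%g = 1. Proof. by []. Qed.
Lemma e12_1 : e12 1%g = 0. Proof. by []. Qed.
Lemma e21_1 : e21 1%g = 0. Proof. by []. Qed.
Lemma e22_1 : e22 1%g = 1. Proof. by []. Qed.
Definition e_1 := (e11_1, e12_1, e21_1, e22_1).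

Definition eM := (e11M, e12M, e21M, e22M).
Definition eV := (e11V, e12V, e21V, e22V).

Lemma e11_mk a b c d H : e11 (@mk2 a b c d H) = a. Proof. by []. Qed.
Lemma e12_mk a b c d H : e12 (@mk2 a b c d H) = b. Proof. by []. Qed.
Lemma e21_mk a b c d H : e21 (@mk2 a b c d H) = c. Proof. by []. Qed.
Lemma e22_mk a b c d H : e22 (@mk2 a b c d H) = d. Proof. by []. Qed.
Definition e_mk := (e11_mk, e12_mk, e21_mk, e22_mk).

Fact upper_proof x : 1 * 1 - x * 0 = 1 :> R. Proof. by ring. Qed.
Definition upper x := mk2 (upper_proof x).
Fact lower_proof x : 1 * 1 - 0 * x = 1 :> R. Proof. by ring. Qed.
Definition lower x := mk2 (lower_proof x).
Fact weyl_proof : 0 * 0 - (- 1) * 1 = 1 :> R. Proof. by ring. Qed.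
Definition weyl := mk2 weyl_proof.
Fact diag_proof t s : t * s = 1 -> t * s - 0 * 0 = 1 :> R. Proof. by move->; ring. Qed.
Definition diag2 t s (H : t * s = 1) := mk2 (diag_proof H).

Fact flip_proof g : e22 g * e11 g - e12 g * e21 g = 1.
Proof. by rewrite mulrC sl2_det. Qed.
(* The anti-automorphism [g |-> P g^-1 P^-1] with [P = diag(1,-1)]. *)
Definition flip g := mk2 (flip_proof g).

Lemma flipM g h : flip (g * h)%g = (flip h * flip g)%g.
Proof. by apply: sl2_eq; rewrite !(eM, e_mk); ring. Qed.

Lemma flipK : involutive flip.
Proof. by move=> g; apply: sl2_eq. Qed.

Lemma flip_upper x : flip (upper x) = upper x.
Proof. exact: sl2_eq. Qed.

Lemma flip_id g : e11 g = e22 g -> flip g = g.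
Proof. by move=> H; apply: sl2_eq; rewrite /flip /e11 /e22 //=. Qed.

Lemma upper0 : upper 0 = 1%g. Proof. exact: sl2_eq. Qed.

Lemma upperD x y : upper (x + y) = (upper x * upper y)%g.
Proof. by apply: sl2_eq; rewrite !(eM, e_mk); ring. Qed.

Lemma upperN x : upper (- x) = (upper x)^-1%g.
Proof. by apply: sl2_eq; rewrite !(eV, e_mk); ring. Qed.

End SpecialLinear.

(** * Arithmetic modulo p^n *)

Lemma closed_prim_root (C : numClosedFieldType) n :
  (0 < n)%N -> exists z : C, n.-primitive_root z.
Proof.
pose p : {poly C} := 'X^n - 1; have [r Dp] := closed_field_poly_normal p.
move=> n_gt0; rewrite (monicP _) ?monicXnsubC // scale1r in Dp.
have rn1 : all n.-unity_root r by apply/allP=> z; rewrite -root_prod_XsubC -Dp.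
have sz_r : (n < (size r).+1)%N.
  by rewrite -(size_prod_XsubC r id) -Dp size_XnsubC.
have [|z] := hasP (has_prim_root n_gt0 rn1 _ sz_r); last by exists z.
by rewrite -separable_prod_XsubC -Dp separable_Xn_sub_1 // pnatr_eq0 -lt0n.
Qed.

(** The fibres are translates of one another, by values of the section [g]. *)
Lemma card_additive_fiber (V W : finZmodType) (f : V -> W) (g : W -> V) w :
  {morph f : x y / x + y} -> cancel g f ->
  (#|W| * #|[set x | f x == w]| = #|V|)%N.
Proof.
move=> fD gK; have fN x y : f (x - y) = f x - f y.
  by apply: (addIr (f y)); rewrite -fD !subrK.
have fib w' : #|[set x | f x == w']| = #|[set x | f x == w]|.
  rewrite -[LHS](card_imset _ (addrI (g (w - w')))).
  apply: eq_card => x; rewrite inE; apply/imsetP/eqP => [[x']|fx].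
    by rewrite inE => /eqP fx' ->; rewrite fD gK fx' subrK.
  exists (x - g (w - w')); last by rewrite addrC subrK.
  by rewrite inE fN gK fx opprB addrC subrK.
rewrite -[RHS]cardsT -[RHS]sum1_card [RHS](partition_big f xpredT) //=.
rewrite [RHS](eq_bigr (fun=> #|[set x | f x == w]|)) => [|w' _]; last first.
  by rewrite -(fib w') -sum1_card; apply: eq_bigl => x; rewrite !inE.
by rewrite sum_nat_const.
Qed.

Section Zmod.
Variable N : nat.
Hypothesis N1 : (1 < N)%N.

Lemma Zp_natr_eq (k l : nat) : ((k%:R : 'Z_N) == l%:R) = (k == l %[mod N]).
Proof. by rewrite -val_eqE /= !val_Zp_nat. Qed.

Lemma Zp_natr_eq0 k : ((k%:R : 'Z_N) == 0) = (N %| k)%N.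
Proof. by rewrite -[0]/(0%:R) Zp_natr_eq mod0n. Qed.

Lemma Zp_valK (x : 'Z_N) : (nat_of_ord x)%:R = x.
Proof. exact: natr_Zp. Qed.

Lemma Zp_val_lt (x : 'Z_N) : (nat_of_ord x < N)%N.
Proof. by apply: leq_trans (ltn_ord x) _; rewrite Zp_cast. Qed.

(* Z/N is self-injective. *)
Lemma Zp_dvd_annihilator (c e : 'Z_N) :
  (forall x, c * x = 0 -> e * x = 0) -> exists k, e = c * k.
Proof.
(* With g = gcd(c, N), the element N/g kills c, hence e; so g divides e, and Bezout makes g a
   multiple of c modulo N. *)
move=> ann; pose g := gcdn (nat_of_ord c) N.
have g0 : (0 < g)%N by rewrite gcdn_gt0 orbC (ltnW N1).
have gN : (g %| N)%N by exact: dvdn_gcdr.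
have : e * (N %/ g)%:R = 0.
  apply: ann; rewrite -[c]Zp_valK -natrM; apply/eqP; rewrite Zp_natr_eq0.
  have /dvdnP[k ->] : (g %| nat_of_ord c)%N by exact: dvdn_gcdl.
  by rewrite -mulnA [(g * _)%N]mulnC divnK // dvdn_mull.
rewrite -[e]Zp_valK -natrM => /eqP; rewrite Zp_natr_eq0 => Neg.
have ge : (g %| nat_of_ord e)%N.
  by rewrite -(@dvdn_pmul2r (N %/ g)) ?divn_gt0 ?(dvdn_leq (ltnW N1)) // mulnC divnK.
have /dvdnP[k ke] := ge; have [a _ Na] := Bezoutl (nat_of_ord c) (ltnW N1).
exists (- (k * a)%:R); apply/eqP; rewrite mulrN -addr_eq0.
rewrite Zp_valK.
have -> : e + c * (k * a)%:R = (k * g + nat_of_ord c * (k * a))%N%:R.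
  by rewrite natrD -ke (natrM _ (nat_of_ord c)) !Zp_valK.
by rewrite Zp_natr_eq0 /g gcdnC mulnCA -mulnDr [(nat_of_ord c * a)%N]mulnC dvdn_mull.
Qed.

Section Pairing.
Variables (C : numClosedFieldType) (w : C).
Hypothesis prim_w : N.-primitive_root w.

Definition Zp_pair (y x : 'Z_N) : C := w ^+ nat_of_ord (y * x).

Lemma Zp_pair_nat k : w ^+ nat_of_ord (k%:R : 'Z_N) = w ^+ k.
Proof. by rewrite val_Zp_nat // prim_expr_mod. Qed.

Lemma Zp_pair_eq y x x' : (Zp_pair y x == Zp_pair y x') = (y * x == y * x').
Proof.
by rewrite /Zp_pair (eq_prim_root_expr prim_w) !modn_small ?Zp_val_lt.
Qed.

Lemma Zp_pairP : perfect_pairing Zp_pair.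
Proof.
split=> [x y|y x x'|y|y H].
- by rewrite /Zp_pair mulrC.
- rewrite /Zp_pair mulrDr -exprD -(Zp_pair_nat (_ + _)) natrD !Zp_valK //.
- by rewrite /Zp_pair mulr0 expr0.
apply/eqP; rewrite -[y]mulr1 -(mulr0 y) -Zp_pair_eq (H 1).
by rewrite /Zp_pair mulr0 expr0.
Qed.
End Pairing.
End Zmod.

Section PrimePower.
Variables (p : nat) (pr_p : prime p).

Lemma pfactor_gt1 n : (1 < p ^ n.+1)%N.
Proof. by rewrite -(exp1n n.+1) ltn_exp2r // prime_gt1. Qed.

Section Level.
Variable n : nat.
Local Notation R := 'Z_(p ^ n.+1).
Local Notation F := 'Z_(p ^ 1).
Let N1 := pfactor_gt1 n.
Let p1 := pfactor_gt1 0.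

Lemma card_Zpn : #|{: R}| = (p ^ n.+1)%N.
Proof. by rewrite card_ord Zp_cast. Qed.

(** The residue field is written ['Z_(p ^ 1)] so that it is literally the case n = 0 of R: results
    on SL2(Z/p^(n+1)) then specialise to SL2(F_p) without transport. *)
Definition modp (x : R) : F := (nat_of_ord x)%:R.

Lemma modp_nat k : modp k%:R = k%:R.
Proof.
apply/eqP; rewrite /modp (Zp_natr_eq p1) val_Zp_nat // modn_dvdm //.
exact: dvdn_exp2l.
Qed.

Lemma modpD x y : modp (x + y) = modp x + modp y.
Proof. by rewrite -[x]Zp_valK // -[y]Zp_valK // -natrD !modp_nat natrD. Qed.

Lemma modpM x y : modp (x * y) = modp x * modp y.
Proof. by rewrite -[x]Zp_valK // -[y]Zp_valK // -natrM !modp_nat natrM. Qed.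

Lemma modp1 : modp 1 = 1. Proof. exact: (modp_nat 1). Qed.
Lemma modp0 : modp 0 = 0. Proof. exact: (modp_nat 0). Qed.

Lemma modpN x : modp (- x) = - modp x.
Proof. by apply/eqP; rewrite -addr_eq0 -modpD addNr modp0. Qed.

Definition liftp (z : F) : R := (nat_of_ord z)%:R.

Lemma liftpK : cancel liftp modp.
Proof. by move=> z; rewrite modp_nat Zp_valK. Qed.

Lemma unitR x : (x \is a GRing.unit) = (modp x != 0).
Proof.
rewrite -[in LHS](Zp_valK x) unitZpE // coprime_pexpl // prime_coprime //.
by rewrite /modp (Zp_natr_eq0 p1).
Qed.

Lemma card_modp_fiber z : #|[set x : R | modp x == z]| = (p ^ n)%N.
Proof.
have cF : p = #|{: F}| by rewrite [RHS]card_ord Zp_cast.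
have E := @card_additive_fiber R F modp liftp z modpD liftpK.
apply/eqP; rewrite -(eqn_pmul2l (prime_gt0 pr_p)); apply/eqP.
rewrite [X in (X * _)%N = _]cF; exact: etrans E (etrans card_Zpn (expnS p n)).
Qed.

(** Counting replaces Hensel's lemma: squaring maps the finite set of elements congruent to 1 into
    itself, and is injective there since t + t' is congruent to 2, a unit. *)
Lemma sqrt_one_unit x : p <> 2%N -> modp x = 1 ->
  exists t, modp t = 1 /\ t * t = x.
Proof.
move=> p2 x1; pose S := [set x : R | modp x == 1].
have two_neq0 : (1 + 1 : F) != 0.
  rewrite -[1 + 1]/(2%:R) (Zp_natr_eq0 p1) dvdn_prime2 //.
  exact/eqP.
have inj : {in S &, injective (fun t => t * t)}.
  move=> t t'; rewrite !inE => /eqP t1 /eqP t1' /= tt.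
  have u : t + t' \is a GRing.unit by rewrite unitR modpD t1 t1'.
  apply/eqP; rewrite -subr_eq0; apply/eqP/(mulIr u).
  by rewrite mul0r -subr_sqr !expr2 tt subrr.
have sub : (fun t => t * t) @: S \subset S.
  apply/fintype.subsetP => x' /imsetP[t + ->]; rewrite !inE => /eqP t1.
  by rewrite modpM t1 mulr1.
have /eqP SS : (fun t => t * t) @: S == S.
  rewrite eqEcard; apply/andP; split; first exact: sub.
  by rewrite (card_in_imset inj).
have : x \in (fun t => t * t) @: S by rewrite SS inE x1.
by case/imsetP => t; rewrite inE => /eqP t1 ->; exists t.
Qed.

(* The embedding of F_p in Z/p^(n+1) as the ideal generated by [p^n]. *)
Definition socp (z : F) : R := (p ^ n * nat_of_ord z)%:R.

Lemma socpE z : socp z = (p ^ n * nat_of_ord z)%:R.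
Proof. by []. Qed.

Lemma socp_nat k : socp k%:R = (p ^ n * k)%:R.
Proof.
apply/eqP; rewrite /socp (Zp_natr_eq N1) val_Zp_nat // (expnSr p n) expn1.
by rewrite -!muln_modr modn_mod.
Qed.

Lemma socpD z z' : socp (z + z') = socp z + socp z'.
Proof.
by rewrite -[z]Zp_valK -[z']Zp_valK -natrD !socp_nat -natrD mulnDr.
Qed.

Lemma socp0 : socp 0 = 0. Proof. by rewrite /socp muln0. Qed.

Lemma mul_socp x z : x * socp z = socp (modp x * z).
Proof.
rewrite -[x]Zp_valK -[z]Zp_valK modp_nat -natrM !socp_nat -natrM.
by rewrite mulnCA.
Qed.

Lemma socp_eq0 z : (socp z == 0) = (z == 0).
Proof.
rewrite /socp (Zp_natr_eq0 N1) (expnSr p n) dvdn_pmul2l ?expn_gt0 ?prime_gt0 //.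
by rewrite -[in RHS](Zp_valK z) (Zp_natr_eq0 p1).
Qed.

Lemma socpP x : reflect (exists z, x = socp z) (p ^ n %| nat_of_ord x)%N.
Proof.
apply: (iffP idP) => [/dvdnP[k kx]|[z ->]]; last first.
  by rewrite /socp val_Zp_nat // (expnSr p n) -muln_modr dvdn_mulr.
by exists k%:R; rewrite socp_nat mulnC -kx Zp_valK.
Qed.

Lemma modp_socp z : (0 < n)%N -> modp (socp z) = 0.
Proof.
move=> n0; apply/eqP; rewrite /socp modp_nat // (Zp_natr_eq0 p1).
by rewrite dvdn_mulr // expn1 dvdn_exp.
Qed.

End Level.
End PrimePower.

(** * Multiplicity one for primitive characters of U *)

Section Whittaker.
Variables (C : numClosedFieldType) (p n : nat) (w : C) (d : nat).
Local Notation R := 'Z_(p ^ n.+1).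
Local Notation G := [set: sl2 R]%G.
Variable r : mx_representation C G d.
Hypotheses (pr_p : prime p) (prim_w : (p ^ n.+1).-primitive_root w).
Let N1 := pfactor_gt1 pr_p n.
Let pp := Zp_pairP N1 prim_w.

(** Its rank is the multiplicity of the character of U of index y, that is, the dimension of the
    space of Whittaker functionals. The character is primitive when y is a unit. *)
Definition whittaker (y : R) : 'M[C]_d := fourier_proj (Zp_pair w) (r \o @upper R) y.
Local Notation E := whittaker.

Lemma repr_upper0 : (r \o @upper R) 0 = 1%:M.
Proof. by rewrite /= upper0 repr_mx1. Qed.

Lemma repr_upperD x x' :
  (r \o @upper R) (x + x') = (r \o @upper R) x *m (r \o @upper R) x'.
Proof. by rewrite /= upperD repr_mulT. Qed.

Lemma whittaker_idem y : E y *m E y = E y.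
Proof. exact: (fourier_idem pp repr_upperD). Qed.

Lemma whittaker_mull y x : r (upper x) *m E y = Zp_pair w y x *: E y.
Proof. exact: (fourier_mull pp repr_upperD). Qed.

Lemma whittaker_mulr y x : E y *m r (upper x) = Zp_pair w y x *: E y.
Proof. exact: (fourier_mulr pp repr_upperD). Qed.

(** Mackey's condition on a double coset of U: the two sides of the conjugation relation multiply
    the same operator by different values of the character. *)
Lemma whittaker_vanish y x x' g :
  (g * upper x = upper x' * g)%g -> y * x != y * x' -> E y *m r g *m E y = 0.
Proof.
move=> gx; rewrite -(Zp_pair_eq N1 prim_w) -subr_eq0 => nz.
apply: (scalerI nz); rewrite scaler0 scalerBl.
have : E y *m r (g * upper x)%g *m E y = E y *m r (upper x' * g)%g *m E y by rewrite gx.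
rewrite !repr_mulT !mulmxA whittaker_mulr -(mulmxA _ (r (upper x))) whittaker_mull.
by rewrite -!scalemxAl -!scalemxAr => ->; rewrite subrr.
Qed.

(* A nonzero double coset operator [E g E] can be moved by [U] to a fixed
   point of [flip] when [e21 g] divides [e11 g - e22 g]; otherwise some
   [upper x] is conjugated by [g] to an element on which [psi_y] differs. *)
Lemma whittaker_flip y g : modp y != 0 ->
  E y *m r (flip g) *m E y = E y *m r g *m E y.
Proof.
rewrite -(unitR pr_p) => uy.
have [] := boolP [forall x, (e21 g * x == 0) ==> ((e22 g - e11 g) * x == 0)].
  move/forallP => ann.
  have [x cx|k kE] := Zp_dvd_annihilator N1 (c := e21 g) (e := e22 g - e11 g).
    by apply/eqP/(implyP (ann x))/eqP.
  (* Left multiplication by [upper k] adds k e21 to e11, which makes the two diagonal entries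
     equal. *)
  have [h hE] : exists h, h = (upper k * g)%g by exists (upper k * g)%g.
  have fh : flip h = h.
    apply: flip_id; rewrite hE e11M e22M !e_mk mul1r mul0r add0r mul1r mulrC -kE.
    by rewrite addrC subrK.
  have -> : g = (upper (- k) * h)%g by rewrite hE upperN mulKg.
  rewrite flipM fh flip_upper !repr_mulT !mulmxA whittaker_mulr.
  by rewrite -(mulmxA _ (r (upper _))) whittaker_mull -!scalemxAl -!scalemxAr.
rewrite negb_forall => /existsP[x]; rewrite negb_imply => /andP[/eqP cx adx].
(* As e21 kills x, conjugation by g acts on x as multiplication by e11^2. *)
have gx : (g * upper x = upper (e11 g * e11 g * x) * g)%g.
  have H : e11 g * e22 g = 1 + e12 g * e21 g by rewrite -(sl2_det g) subrK.
  apply: sl2_eq; rewrite !eM !e_mk ?mul1r ?mul0r ?mulr1 ?mulr0 ?addr0 ?add0r //.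
  - by rewrite -mulrA [x * _]mulrC cx mulr0 addr0.
  - rewrite addrC; congr (_ + _).
    transitivity (e11 g * (e11 g * e22 g) * x); last by ring.
    rewrite H; transitivity (e11 g * x + e11 g * e12 g * (e21 g * x)); last by ring.
    by rewrite cx mulr0 addr0.
  - by rewrite cx add0r.
have ua : e11 g \is a GRing.unit.
  rewrite (unitR pr_p); apply: contraNneq adx => a0.
  have uc : e21 g \is a GRing.unit.
    rewrite (unitR pr_p); apply: contra_eq_neq (congr1 (@modp p n) (sl2_det g)) => c0.
    by rewrite (modpD pr_p) (modpN pr_p) !(modpM pr_p) a0 c0 mul0r mulr0 subrr (modp1 pr_p).
  have -> : x = 0 by apply: (mulrI uc); rewrite mulr0.
  by rewrite mulr0.
(* From e21 x = 0 one has e11 e22 x = x; if also e11^2 x = x, then e11 (e22 - e11) x = 0 with e11 a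
   unit, against the choice of x. *)
have nz : y * x != y * (e11 g * e11 g * x).
  apply: contraNneq adx => /(mulrI uy) xa.
  rewrite -(mulrI_eq0 _ (mulrI ua)) mulrBl mulrBr mulrA.
  have -> : e11 g * e22 g = 1 + e12 g * e21 g by rewrite -(sl2_det g) subrK.
  by rewrite mulrDl mul1r -mulrA cx mulr0 addr0 mulrA -xa subrr.
rewrite (whittaker_vanish gx nz) (whittaker_vanish (x := e11 g * e11 g * x) (x' := x)) //.
  by have := congr1 (@flip R) gx; rewrite !flipM !flip_upper.
by rewrite eq_sym.
Qed.

Hypothesis irr : mx_irreducible r.

(** Gelfand's trick: an anti-automorphism that fixes every E r(g) E forces the algebra they span to
    be commutative, and by irreducibility they span the whole corner E M_d E. *)
Lemma whittaker_rank y : modp y != 0 -> (\rank (E y) <= 1)%N.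
Proof.
move=> uy; apply: commutative_corner_rank => [|X Y]; first exact: whittaker_idem.
have corner g1 g2 : E y *m r g1 *m E y *m r g2 *m E y =
    #|{: R}|%:R^-1 *: \sum_x Zp_pair w y (- x) *: (E y *m r (g1 * upper x * g2)%g *m E y).
  rewrite {2}/whittaker fourier_projE -!scalemxAr -!scalemxAl; congr (_ *: _).
  rewrite mulmx_sumr !mulmx_suml; apply: eq_bigr => x _.
  by rewrite -!scalemxAr -!scalemxAl /= !repr_mulT !mulmxA.
have comm g1 g2 : E y *m r g1 *m E y *m r g2 *m E y = E y *m r g2 *m E y *m r g1 *m E y.
  transitivity (E y *m r (flip g2) *m E y *m r (flip g1) *m E y).
    rewrite !corner; congr (_ *: _); apply: eq_bigr => x _; congr (_ *: _).
    by rewrite -whittaker_flip // !flipM flip_upper mulgA.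
  rewrite whittaker_flip //.
  have -> : E y *m r g2 *m E y *m r (flip g1) *m E y
      = E y *m r g2 *m (E y *m r (flip g1) *m E y) by rewrite !mulmxA.
  by rewrite whittaker_flip // !mulmxA.
have comm1 Z h : E y *m Z *m E y *m r h *m E y = E y *m r h *m E y *m Z *m E y.
  have [a ->] := irr_span irr Z.
  rewrite mulmx_sumr [in RHS]mulmx_sumr !mulmx_suml; apply: eq_bigr => g _.
  by rewrite -!scalemxAr -!scalemxAl comm.
have [a ->] := irr_span irr Y.
rewrite [in LHS]mulmx_sumr [in RHS]mulmx_sumr !mulmx_suml; apply: eq_bigr => g _.
by rewrite -!scalemxAr -!scalemxAl comm1.
Qed.
End Whittaker.

(** * SL2 over F_p *)

Section PrimeField.
Variables (p : nat) (pr_p : prime p).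
Local Notation F := 'Z_(p ^ 1).
Local Notation G := [set: sl2 F]%G.

Lemma card_Fp : #|{: F}| = p.
Proof. by rewrite card_ord Zp_cast // (pfactor_gt1 pr_p 0). Qed.

Lemma modp_id (x : F) : modp x = x.
Proof. exact: Zp_valK. Qed.

Lemma unitFp (x : F) : (x \is a GRing.unit) = (x != 0).
Proof. by rewrite (unitR pr_p) modp_id. Qed.

Lemma Fp_mulf_eq0 (x y : F) : (x * y == 0) = (x == 0) || (y == 0).
Proof.
have [->|x0] := eqVneq x 0; first by rewrite mul0r eqxx.
apply/eqP/eqP => [|->]; last exact: mulr0.
by rewrite -unitFp in x0 => xy; apply: (mulrI x0); rewrite xy mulr0.
Qed.

Lemma Fp_two_neq0 : p <> 2%N -> 1 + 1 != 0 :> F.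
Proof.
move=> p2; rewrite -[1 + 1]/(2%:R) (Zp_natr_eq0 (pfactor_gt1 pr_p 0)) dvdn_prime2 //.
exact/eqP.
Qed.

Lemma Fp_solve_linear (b e : F) : b != 0 -> (\sum_c ((b * c)%R == e) = 1)%N.
Proof.
rewrite -unitFp => ub; rewrite (bigD1 (b^-1 * e)) //= mulVKr // eqxx.
rewrite big1 // => c nc; apply/eqP; rewrite eqb0; apply: contraNneq nc => <-.
by rewrite mulKr.
Qed.

(** The fixed elements solve a^2 - b c = 1. For b nonzero, a is free and determines c; for b = 0, a
    is 1 or -1 and c is free. *)
Lemma card_flip_fixed : p <> 2%N -> #|[set g : sl2 F | flip g == g]| = (p ^ 2 + p)%N.
Proof.
move=> p2; pose f (g : sl2 F) := (e12 g, e11 g, e21 g).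
have fixP (g : sl2 F) : flip g == g -> e22 g = e11 g.
  by move=> /eqP fg; rewrite -{2}fg.
rewrite -(card_in_imset (f := f)); last first.
  move=> g h; rewrite !inE => /fixP dg /fixP dh [b a c].
  by apply: sl2_eq; rewrite ?dg ?dh.
have -> : f @: [set g | flip g == g]
    = [set v : F * F * F | v.1.2 * v.1.2 - v.1.1 * v.2 == 1].
  apply/finset.setP => [[[b a] c]]; rewrite inE /=; apply/imsetP/eqP => [[g]|H].
    by rewrite inE => /fixP dg [-> -> ->]; rewrite -(sl2_det g) dg.
  exists (mk2 H) => //; rewrite inE; apply/eqP/flip_id.
  by [].
rewrite -sum1_card big_mkcond /=.
under eq_bigr do rewrite inE.
rewrite (eq_bigr (fun v : F * F * F => (v.1.2 * v.1.2 - v.1.1 * v.2 == 1) : nat)) //.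
rewrite -(pair_bigA _ (fun ba c => (ba.2 * ba.2 - ba.1 * c == 1) : nat)) /=.
rewrite -(pair_bigA _ (fun b a => \sum_c ((a * a - b * c == 1)%R : nat))%N) /=.
have -> : (p ^ 2 + p = p.-1 * p + 2 * p)%N.
  by case: (p) (prime_gt0 pr_p) => // q _; rewrite expnS expn1 /=; ring.
rewrite (bigD1 0) //= addnC; congr (_ + _)%N.
  rewrite (eq_bigr (fun=> p)) => [|b b0].
    by rewrite sum_nat_const cardC1 card_Fp.
  rewrite (eq_bigr (fun=> 1%N)) => [|a _]; first by rewrite sum_nat_const card_Fp muln1.
  rewrite -[RHS](Fp_solve_linear (a * a - 1) b0); apply: eq_bigr => c _.
  by rewrite subr_eq addrC -subr_eq eq_sym.
have one_two : 1 != -1 :> F by rewrite -subr_eq0 opprK Fp_two_neq0.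
rewrite (eq_bigr (fun a => if a * a == 1 then p else 0%N)) => [|a _]; last first.
  under eq_bigr do rewrite mul0r subr0.
  by rewrite sum_nat_const card_Fp; case: eqP; rewrite ?muln1 ?muln0.
rewrite -big_mkcond (eq_bigl (mem [set 1; -1])) => [|a].
  by rewrite sum_nat_const cards2 one_two.
by rewrite !inE -[a * a]expr2 -subr_eq0 subr_sqr_1 Fp_mulf_eq0 subr_eq0 addr_eq0.
Qed.

Lemma card_SL2Fp : (#|{: sl2 F}| + p = p ^ 3)%N.
Proof.
have -> : #|{: sl2 F}| = #|[set v : F * F * F * F | v.1.1.1 * v.2 - v.1.1.2 * v.1.2 == 1]|.
  rewrite -(card_imset _ (@val_inj _ _ (sl2 F))) /=; apply: eq_card => v.
  rewrite inE; apply/imsetP/idP => [[g _ ->]|H]; first by case: g.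
  by exists (Sl2 H).
rewrite -sum1_card big_mkcond /=.
under eq_bigr do rewrite inE.
rewrite (eq_bigr (fun v : F * F * F * F => (v.1.1.1 * v.2 - v.1.1.2 * v.1.2 == 1) : nat)) //.
rewrite -(pair_bigA _ (fun v d => (v.1.1 * d - v.1.2 * v.2 == 1) : nat)) /=.
rewrite -(pair_bigA _ (fun v c => \sum_d ((v.1 * d - v.2 * c == 1)%R : nat))%N) /=.
rewrite -(pair_bigA _ (fun a b => \sum_c \sum_d ((a * d - b * c == 1)%R : nat))%N) /=.
rewrite (bigD1 0) //=.
rewrite [X in (_ + X + _)%N](eq_bigr (fun=> (p * p)%N)) => [|a a0]; last first.
  rewrite (eq_bigr (fun=> p)) => [|b _]; first by rewrite sum_nat_const card_Fp.
  rewrite (eq_bigr (fun=> 1%N)) => [|c _]; first by rewrite sum_nat_const card_Fp muln1.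
  rewrite -[RHS](Fp_solve_linear (1 + b * c) a0).
  by apply: eq_bigr => d _; rewrite subr_eq.
rewrite (bigD1 0) //= [X in (X + _ + _ + _)%N]big1 => [|c _]; last first.
  by rewrite big1 // => d _; rewrite !mul0r subr0 eq_sym oner_eq0.
rewrite (eq_bigr (fun=> p)) => [|b b0]; last first.
  rewrite exchange_big (eq_bigr (fun=> 1%N)) => [|c _].
    by rewrite sum_nat_const card_Fp muln1.
  rewrite -[RHS](Fp_solve_linear (- 1) b0); apply: eq_bigr => d _.
  by rewrite mul0r sub0r eqr_oppLR.
rewrite !sum_nat_const !cardC1 card_Fp add0n.
by case: (p) (prime_gt0 pr_p) => // q _; rewrite !expnS expn0 /=; ring.
Qed.

(** An element with e21 nonzero is a product upper, lower, upper. Any other acquires a nonzero e21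
    after left multiplication by [lower 1]. *)
Lemma Fp_gen (H : {set sl2 F}) : group_set H ->
  (forall x, upper x \in H) -> (forall x, lower x \in H) -> H = finset.setT.
Proof.
move=> gH uH lH; pose K := Group gH; apply/eqP; rewrite finset.eqEsubset finset.subsetT /=.
have big g : e21 g != 0 -> g \in K.
  rewrite -unitFp => uc.
  have [s sc] : exists s, s * e21 g = e11 g - 1.
    by exists ((e11 g - 1) / e21 g); rewrite divrK.
  have [t tc] : exists t, t * e21 g = e22 g - 1.
    by exists ((e22 g - 1) / e21 g); rewrite divrK.
  have -> : g = (upper s * lower (e21 g) * upper t)%g.
    apply: sl2_eq; rewrite !(eM, eV, e_mk).
    - by transitivity (1 + s * e21 g); [rewrite sc addrC subrK | ring].
    - apply: (mulIr uc).
      transitivity (t * e21 g + s * e21 g * (t * e21 g) + s * e21 g); last by ring.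
      have bc : e12 g * e21 g = e11 g * e22 g - 1.
        by rewrite -[in RHS](sl2_det g) opprB addrC subrK.
      by rewrite sc tc bc; ring.
    - by ring.
    - by transitivity (1 + t * e21 g); [rewrite tc addrC subrK | ring].
  by rewrite !(@groupM _ K) //; first [exact: uH | exact: lH].
apply/fintype.subsetP => g _; have [c0|] := eqVneq (e21 g) 0; last exact: big.
rewrite -(groupMl (x := lower 1) (G := K)) //; apply: big.
rewrite e21M !e_mk c0 mulr0 addr0 mul1r; apply: contraTneq isT => a0.
have := sl2_det g; rewrite a0 c0 mul0r mulr0 subrr => /esym/eqP.
by rewrite oner_eq0.
Qed.

Lemma lower_weyl (R : finComNzRingType) x :
  lower x = ((weyl R)^-1 * upper (- x) * weyl R)%g.
Proof. by apply: sl2_eq; rewrite !(eM, eV, e_mk); ring. Qed.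

Variable C : numClosedFieldType.

(** If a nontrivial character of U occurs, its projection has rank one and is as wanted. Otherwise U
    acts trivially, hence so does the group generated by U and its Weyl conjugate, and every rank
    one idempotent serves. *)
Lemma irr_SL2Fp_corner d (r : mx_representation C G d) : mx_irreducible r ->
  exists E : 'M[C]_d, [/\ E *m E = E, \rank E = 1%N
    & forall g, E *m r (flip g) *m E = E *m r g *m E].
Proof.
move=> irr; have [w prim_w] := closed_prim_root C (ltnW (pfactor_gt1 pr_p 0)).
have pp := Zp_pairP (pfactor_gt1 pr_p 0) prim_w.
have [/existsP[y /andP[y0 Ey]]|] :=
    boolP [exists y : F, (y != 0) && (whittaker w r y != 0)].
  rewrite -(modp_id y) in y0; exists (whittaker w r y); split.
  - exact: (whittaker_idem (n := 0) r pr_p prim_w).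
  - apply/eqP; rewrite eqn_leq lt0n mxrank_eq0 Ey andbT.
    exact: (whittaker_rank (n := 0) pr_p prim_w irr y0).
  - by move=> g; exact: (whittaker_flip (n := 0) r pr_p prim_w).
rewrite negb_exists => /forallP E0.
have E1 : whittaker w r (0 : F) = 1%:M.
  rewrite -(fourier_sum pp (repr_upper0 (n := 0) r)).
  rewrite (bigD1 0) //= big1 ?addr0 // => y y0.
  by move: (E0 y); rewrite y0 /= negbK => /eqP.
have ru x : r (upper x) = 1%:M.
  exact: (fourier_trivial pp (repr_upperD (n := 0) r) E1).
have r1 g : r g = 1%:M.
  suff : [set g | r g == 1%:M] = finset.setT.
    by move=> /finset.setP /(_ g); rewrite !inE => /eqP.
  apply: Fp_gen => [|x|x]; rewrite ?inE ?ru //.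
    apply/group_setP; split=> [|g1 g2]; rewrite !inE ?repr_mx1 // => /eqP H1 /eqP H2.
    by rewrite repr_mulT H1 H2 mulmx1.
  rewrite lower_weyl !repr_mulT ru mulmx1 -repr_mulT mulVg repr_mx1 //.
pose i0 := Ordinal (irr_dim_gt0 irr).
exists (delta_mx i0 i0); split=> [||g]; first exact: mul_delta_mx.
  exact: mxrank_delta.
by rewrite !r1.
Qed.

(** Weighting the twisted count by degrees and exchanging sums turns it into the regular character
    at flip(g) g^-1, which detects the fixed points of [flip]. *)
Lemma sum_irr_degree_SL2Fp (sG : irrType C G) : p <> 2%N ->
  (\sum_(i : sG) irr_degree i = p ^ 2 + p)%N.
Proof.
move=> p2; have G0 : #|{: sl2 F}|%:R != 0 :> C.
  by rewrite pnatr_eq0 -cardsT -lt0n cardG_gt0.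
apply/eqP; rewrite -(eqr_nat C) -(card_flip_fixed p2); apply/eqP/(mulfI G0).
transitivity (\sum_(i : sG) (irr_degree i)%:R * \sum_g \tr (irr_repr i (flip g * g^-1)%g)).
  rewrite natr_sum mulr_sumr; apply: eq_bigr => i _; rewrite mulrC; congr (_ * _).
  have irr := socle_irr i; have [E [EE rE fE]] := irr_SL2Fp_corner irr.
  exact/esym/(twisted_frobenius_schur irr (@flipM F) (@flipK F) EE rE fE).
under eq_bigr do rewrite mulr_sumr.
rewrite exchange_big /=.
under eq_bigr do rewrite (sum_irr_trace sG (finset.in_setT _)) cardsT.
rewrite -mulr_sumr; congr (_ * _); rewrite -sum1_card natr_sum [in RHS]big_mkcond /=.
apply: eq_bigr => g _; rewrite inE -eq_mulgV1; by case: eqP.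
Qed.
End PrimeField.

(** * The adjoint representation *)

Section Adjoint.
Variable R : finComNzRingType.

(* The triple [(x, y, z)] stands for the trace zero matrix [[x, y], [z, -x]]. *)
Definition adj (g : sl2 R) (Y : R * R * R) : R * R * R :=
  let: (x, y, z) := Y in
  ((e11 g * e22 g + e12 g * e21 g) * x - e11 g * e21 g * y + e12 g * e22 g * z,
   - (e11 g * e12 g + e11 g * e12 g) * x + e11 g * e11 g * y - e12 g * e12 g * z,
   (e21 g * e22 g + e21 g * e22 g) * x - e21 g * e21 g * y + e22 g * e22 g * z).

(** The trace form tr(Y X) on trace zero matrices. *)
Definition trform (Y X : R * R * R) : R :=
  (Y.1.1 * X.1.1) + (Y.1.1 * X.1.1) + Y.1.2 * X.2 + Y.2 * X.1.2.

Definition negdet (Y : R * R * R) : R := Y.1.1 * Y.1.1 + Y.1.2 * Y.2.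

Lemma adjM g h Y : adj (g * h)%g Y = adj g (adj h Y).
Proof. by case: Y => [[x y] z]; rewrite /adj !eM; congr (_, _, _); ring. Qed.

Lemma adj1 Y : adj 1%g Y = Y.
Proof. by case: Y => [[x y] z]; rewrite /adj !e_1; congr (_, _, _); ring. Qed.

Lemma adjK g : cancel (adj g) (adj g^-1%g).
Proof. by move=> Y; rewrite -adjM mulVg adj1. Qed.

Lemma adjN g : {morph adj g : X / - X}.
Proof. by case=> [[x y] z]; congr (_, _, _); rewrite /=; ring. Qed.

Lemma adj0 g : adj g 0 = 0.
Proof.
rewrite -[0]/((0, 0, 0) : R * R * R); congr (_, _, _); by rewrite !mulr0 !(addr0, subr0).
Qed.

Lemma trform_adj g Y X : trform (adj g^-1%g Y) X = trform Y (adj g X).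
Proof. by case: Y X => [[x y] z] [[x' y'] z']; rewrite /trform /adj /= !eV; ring. Qed.

Lemma negdet_adj g Y : negdet (adj g Y) = negdet Y.
Proof.
case: Y => [[x y] z]; have H := sl2_det g.
transitivity ((e11 g * e22 g - e12 g * e21 g) ^+ 2 * negdet (x, y, z)).
  by rewrite /negdet /adj /=; ring.
by rewrite H expr1n mul1r.
Qed.

(** The three equations are the entries of g Y = Y g. *)
Lemma adj_fixP g x y z :
  adj g (x, y, z) = (x, y, z) <->
  [/\ e12 g * z = e21 g * y, (e11 g - e22 g) * y = (e12 g + e12 g) * x
    & (e11 g - e22 g) * z = (e21 g + e21 g) * x].
Proof.
have H := sl2_det g.
pose m11 := (e11 g * e22 g + e12 g * e21 g) * x - e11 g * e21 g * y + e12 g * e22 g * z.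
pose m12 := - (e11 g * e12 g + e11 g * e12 g) * x + e11 g * e11 g * y - e12 g * e12 g * z.
pose m21 := (e21 g * e22 g + e21 g * e22 g) * x - e21 g * e21 g * y + e22 g * e22 g * z.
split=> [E|[H1 H2 H3]].
  have [Ex Ey Ez] : [/\ m11 = x, m12 = y & m21 = z] by case: E.
  have A1 : x * e11 g + y * e21 g = e11 g * x + e12 g * z.
    transitivity (m11 * e11 g + m12 * e21 g); first by rewrite Ex Ey.
    by rewrite -[RHS]mul1r -H /m11 /m12; ring.
  have A2 : x * e12 g + y * e22 g = e11 g * y - e12 g * x.
    transitivity (m11 * e12 g + m12 * e22 g); first by rewrite Ex Ey.
    by rewrite -[RHS]mul1r -H /m11 /m12; ring.
  have A3 : z * e11 g - x * e21 g = e21 g * x + e22 g * z.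
    transitivity (m21 * e11 g - m11 * e21 g); first by rewrite Ex Ez.
    by rewrite -[RHS]mul1r -H /m21 /m11; ring.
  split.
  - apply: (addrI (e11 g * x)); rewrite -A1; ring.
  - apply: (addrI (e22 g * y - e12 g * x)).
    transitivity (e11 g * y - e12 g * x); first by ring.
    by rewrite -A2; ring.
  - apply: (addrI (e22 g * z - e21 g * x)).
    transitivity (z * e11 g - x * e21 g); first by ring.
    by rewrite A3; ring.
congr (_, _, _).
- transitivity ((e11 g * e22 g - e12 g * e21 g) * x + e22 g * (e12 g * z - e21 g * y)
    - e21 g * ((e11 g - e22 g) * y - (e12 g + e12 g) * x)); first by ring.
  by rewrite H H1 H2 !subrr !mulr0 subr0 addr0 mul1r.
- transitivity ((e11 g * e22 g - e12 g * e21 g) * y - e12 g * (e12 g * z - e21 g * y)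
    + e11 g * ((e11 g - e22 g) * y - (e12 g + e12 g) * x)); first by ring.
  by rewrite H H1 H2 !subrr !mulr0 subr0 addr0 mul1r.
- transitivity ((e11 g * e22 g - e12 g * e21 g) * z + e21 g * (e12 g * z - e21 g * y)
    - e22 g * ((e11 g - e22 g) * z - (e21 g + e21 g) * x)); first by ring.
  by rewrite H H1 H3 !subrr !mulr0 subr0 addr0 mul1r.
Qed.

End Adjoint.

(** * Counting the nonzero adjoint orbits over F_p *)

Section Burnside.
Variables (p : nat) (pr_p : prime p).
Hypothesis p2 : p <> 2%N.
Local Notation F := 'Z_(p ^ 1).
Let tw := Fp_two_neq0 pr_p p2.

Definition adj_stab (Y : F * F * F) : {set sl2 F} := [set g | adj g Y == Y].

Definition scalar_sl2 (g : sl2 F) := [&& e11 g == e22 g, e12 g == 0 & e21 g == 0].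

Lemma mul2_eq0 (x : F) : (x + x == 0) = (x == 0).
Proof. by rewrite -[x]mul1r -mulrDl Fp_mulf_eq0 // (negPf tw) mul1r. Qed.

(** The centraliser of a non-scalar matrix of size 2 is spanned by 1 and g, and its trace zero part
    is a line. *)
Lemma card_adj_fixed g :
  #|[set Y | adj g Y == Y]| = (if scalar_sl2 g then p ^ 3 else p)%N.
Proof.
have [/and3P[/eqP ad /eqP b0 /eqP c0]|] := boolP (scalar_sl2 g).
  rewrite (_ : [set _ | _] = finset.setT); last first.
    apply/finset.setP => [[[x y] z]]; rewrite !inE; apply/eqP/adj_fixP.
    by rewrite ad b0 c0 subrr addr0 !mul0r.
  by rewrite cardsT !card_prod !(card_Fp pr_p) !expnS muln1 mulnA.
rewrite /scalar_sl2 => ng.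
(* This is t (2 g - tr g), twice the trace zero part of g, scaled. *)
pose f (t : F) := ((e11 g - e22 g) * t, (e12 g + e12 g) * t, (e21 g + e21 g) * t).
have fE Y : adj g Y = Y <-> exists t, Y = f t.
  case: Y => [[x y] z]; rewrite adj_fixP; split=> [[H1 H2 H3]|[t [-> -> ->]]]; last first.
    by split; ring.
  have [b0|b0] := eqVneq (e12 g) 0; last first.
    have ub : e12 g \is a GRing.unit by rewrite (unitFp pr_p).
    have ub2 : e12 g + e12 g \is a GRing.unit by rewrite (unitFp pr_p) mul2_eq0.
    exists ((e12 g + e12 g)^-1 * y).
    have yE : y = (e12 g + e12 g) * ((e12 g + e12 g)^-1 * y) by rewrite mulVKr.
    move: (_ * y) yE => t yE; congr (_, _, _) => //.
      by apply: (mulrI ub2); rewrite -H2 yE; ring.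
    by apply: (mulrI ub); rewrite H1 yE; ring.
  have [c0|c0] := eqVneq (e21 g) 0; last first.
    have uc : e21 g \is a GRing.unit by rewrite (unitFp pr_p).
    have uc2 : e21 g + e21 g \is a GRing.unit by rewrite (unitFp pr_p) mul2_eq0.
    exists ((e21 g + e21 g)^-1 * z).
    have zE : z = (e21 g + e21 g) * ((e21 g + e21 g)^-1 * z) by rewrite mulVKr.
    move: (_ * z) zE => t zE; congr (_, _, _) => //.
      by apply: (mulrI uc2); rewrite -H3 zE; ring.
    by apply: (mulrI uc); rewrite -H1 zE; ring.
  have ua : e11 g - e22 g \is a GRing.unit.
    by rewrite (unitFp pr_p) subr_eq0; move: ng; rewrite b0 c0 eqxx !andbT.
  exists ((e11 g - e22 g)^-1 * x); rewrite /f mulVKr // b0 c0 !addr0 !mul0r.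
  by congr (_, _, _); apply: (mulrI ua); rewrite mulr0 ?H2 ?H3 ?b0 ?c0 addr0 mul0r.
have inj : injective f.
  move=> t t' E.
  have Ex := congr1 (fun v => v.1.1) E; have Ey := congr1 (fun v => v.1.2) E.
  have Ez := congr1 snd E; move: ng; rewrite !negb_and.
  case/or3P => nz.
  - have u : e11 g - e22 g \is a GRing.unit by rewrite (unitFp pr_p) subr_eq0.
        by apply: (mulrI u); exact: Ex.
  - have u : e12 g + e12 g \is a GRing.unit by rewrite (unitFp pr_p) mul2_eq0.
    by apply: (mulrI u); exact: Ey.
  have u : e21 g + e21 g \is a GRing.unit by rewrite (unitFp pr_p) mul2_eq0.
  by apply: (mulrI u); exact: Ez.
rewrite -[RHS](card_Fp pr_p) -(card_imset _ inj).
apply: eq_card => Y; rewrite inE; apply/eqP/imsetP => [/fE[t ->]|[t _ ->]].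
  by exists t.
by apply/fE; exists t.
Qed.

Lemma card_scalar_sl2 : #|[set g | scalar_sl2 g]| = 2%N.
Proof.
have m1 : (- 1) * (- 1) - 0 * 0 = 1 :> F by ring.
have -> : [set g | scalar_sl2 g] = [set 1%g; mk2 m1].
  apply/finset.setP => g; rewrite !inE; apply/and3P/orP => [[/eqP ad /eqP b0 /eqP c0]|].
    have := sl2_det g; rewrite -ad b0 c0 mul0r subr0 -expr2 => /eqP.
    rewrite -subr_eq0 subr_sqr_1 Fp_mulf_eq0 // subr_eq0 addr_eq0.
    by case/orP => /eqP a1; [left|right]; apply/eqP/sl2_eq; rewrite ?e_mk ?e_1 -?ad.
  by case=> /eqP ->; rewrite ?e_mk ?e_1 eqxx.
rewrite cards2; case: eqP => // /(congr1 (@e11 F)) E.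
have /eqP : (1 : F) = - 1 := E.
by rewrite -subr_eq0 opprK (negPf tw).
Qed.

(** Burnside's double count of the pairs (g, Y) with g fixing Y: the elements 1 and -1 fix p^3
    matrices each, every other element fixes p. The term 2 p is moved to the left to avoid a
    subtraction in [nat]. *)
Lemma sum_adj_stab :
  (\sum_(Y : F * F * F) #|adj_stab Y| + 2 * p = 2 * p ^ 3 + #|{: sl2 F}| * p)%N.
Proof.
transitivity (\sum_(g : sl2 F) #|[set Y | adj g Y == Y]| + 2 * p)%N.
  congr (_ + _)%N.
  transitivity (\sum_(Y : F * F * F) \sum_(g : sl2 F) (adj g Y == Y) : nat)%N.
    apply: eq_bigr => Y _; rewrite -sum1_card big_mkcond /=.
    by apply: eq_bigr => g _; rewrite inE.
  rewrite exchange_big; apply: eq_bigr => g _ /=.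
  rewrite -sum1_card [RHS]big_mkcond /=.
  by apply: eq_bigr => Y _; rewrite inE.
under eq_bigr do rewrite card_adj_fixed.
rewrite (bigID scalar_sl2) /=.
rewrite (eq_bigr (fun=> p ^ 3)%N) => [|g ->] //.
rewrite [X in (_ + X + _)%N](eq_bigr (fun=> p)) => [|g /negPf->] //.
rewrite !sum_nat_const -(cardsE scalar_sl2) card_scalar_sl2 -addnA; congr (_ + _)%N.
rewrite -mulnDl; congr (_ * _)%N.
rewrite -(cardsC [set g | scalar_sl2 g]) card_scalar_sl2 addnC; congr (_ + _)%N.
by apply: eq_card => g; rewrite !inE.
Qed.

Lemma adj_stab_dvd Y : (#|adj_stab Y| %| #|{: sl2 F}|)%N.
Proof.
have gS : group_set (adj_stab Y).
  apply/group_setP; split=> [|g h]; rewrite !inE ?adj1 //.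
  by rewrite adjM => /eqP H1 /eqP ->; apply/eqP.
rewrite -[X in (_ %| X)%N]cardsT.
exact: (@cardSg _ [set: sl2 F]%G (Group gS) (finset.subsetT _)).
Qed.

End Burnside.

(** * The kernel of reduction and new representations *)

Section Reduction.
Variables (p : nat) (pr_p : prime p) (n : nat).
Local Notation R := 'Z_(p ^ n.+1).
Local Notation F := 'Z_(p ^ 1).
Let modpE := (modpD pr_p (n := n), modpN pr_p (n := n), modpM pr_p (n := n)).

Fact sl2_red_proof (g : sl2 R) :
  modp (e11 g) * modp (e22 g) - modp (e12 g) * modp (e21 g) = 1.
Proof. by rewrite -!modpM // -modpN // -modpD // sl2_det modp1. Qed.
Definition sl2_red (g : sl2 R) : sl2 F := mk2 (sl2_red_proof g).

Lemma sl2_redM g h : sl2_red (g * h)%g = (sl2_red g * sl2_red h)%g.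
Proof. by apply: sl2_eq; rewrite !eM !e_mk !modpE. Qed.

Lemma sl2_red1 : sl2_red 1%g = 1%g.
Proof. by apply: (mulgI (sl2_red 1%g)); rewrite -sl2_redM !mulg1. Qed.

Lemma sl2_redV g : sl2_red g^-1%g = (sl2_red g)^-1%g.
Proof. by apply: (mulgI (sl2_red g)); rewrite -sl2_redM !mulgV sl2_red1. Qed.

(** With e11 a unit, three entries lift freely and the determinant gives the fourth; otherwise
    [upper 1] on the left first makes e11 nonzero. *)
Lemma sl2_red_surj g0 : exists g, sl2_red g = g0.
Proof.
have lift (a b c d : F) : a * d - b * c = 1 -> a != 0 ->
    exists g, [/\ e11 (sl2_red g) = a, e12 (sl2_red g) = b,
      e21 (sl2_red g) = c & e22 (sl2_red g) = d].
  move=> D a0; have ua : liftp n a \is a GRing.unit by rewrite (unitR pr_p) liftpK.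
  have E : liftp n a * ((liftp n a)^-1 * (1 + liftp n b * liftp n c))
      - liftp n b * liftp n c = 1 by rewrite mulVKr // addrK.
  exists (mk2 E); rewrite !e_mk !liftpK //; split=> //.
  rewrite -(unitFp pr_p) in a0; apply: (mulrI a0).
  rewrite -{1}(liftpK pr_p n a) -modpM // mulVKr // modpD // modp1 // modpM // !liftpK //.
  by rewrite -D subrK.
have lift1 (g1 : sl2 F) : e11 g1 != 0 -> exists g, sl2_red g = g1.
  by case/(lift _ _ _ _ (sl2_det g1)) => g [A B C D]; exists g; apply: sl2_eq.
have [a0|] := eqVneq (e11 g0) 0; last exact: lift1.
have [|g gE] := lift1 (upper 1 * g0)%g.
  rewrite e11M !e_mk a0 mulr0 add0r mul1r; apply: contraTneq isT => c0.
  have := sl2_det g0; rewrite a0 c0 mul0r mulr0 subrr => /esym/eqP.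
  by rewrite oner_eq0.
exists (upper (- 1) * g)%g; rewrite sl2_redM gE.
have -> : sl2_red (upper (- 1)) = (upper 1)^-1%g.
  by apply: sl2_eq; rewrite ?eV !e_mk ?modpN ?modp1 ?modp0 ?oppr0.
by rewrite mulKg.
Qed.

(** Fibres are cosets of the kernel, where e11 is a unit, so that e22 is determined by the other
    entries, each of which has p^n choices. *)
Lemma card_sl2_red_fiber g0 : #|[set g | sl2_red g == g0]| = (p ^ (3 * n))%N.
Proof.
have [h0 <-] := sl2_red_surj g0.
rewrite -[LHS](card_imset _ (mulgI h0^-1)%g).
have -> : [set h0^-1 * g | g in [set g | sl2_red g == sl2_red h0]]%g
    = [set g | sl2_red g == 1%g].
  apply/finset.setP => g; rewrite inE; apply/imsetP/eqP => [[g' + ->]|g1].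
    by rewrite inE => /eqP E; rewrite sl2_redM sl2_redV E mulVg.
  by exists (h0 * g)%g; rewrite ?mulKg // inE sl2_redM g1 mulg1.
pose f (g : sl2 R) := (e11 g, e12 g, e21 g).
rewrite -[LHS](card_in_imset (f := f)); last first.
  move=> g h; rewrite !inE => /eqP Hg /eqP Hh E.
  have A := congr1 (fun v => v.1.1) E; have B := congr1 (fun v => v.1.2) E.
  have C := congr1 snd E; rewrite /= in A B C.
  apply: sl2_eq => //.
  have ua : e11 g \is a GRing.unit.
    rewrite (unitR pr_p); have -> : modp (e11 g) = e11 (sl2_red g) by [].
    by rewrite Hg oner_neq0.
  apply: (mulrI ua); apply: (addIr (- (e12 g * e21 g))); rewrite sl2_det.
  by rewrite A B C sl2_det.
have -> : f @: [set g | sl2_red g == 1%g]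
    = finset.setX (finset.setX [set x | modp x == 1] [set x | modp x == 0]) [set x | modp x == 0].
  apply/finset.setP => [[[a b] c]]; rewrite !inE /=; apply/imsetP/idP => [[g]|].
    rewrite inE => /eqP g1 E.
    have A : a = e11 g := congr1 (fun v => v.1.1) E.
    have B : b = e12 g := congr1 (fun v => v.1.2) E.
    have C : c = e21 g := congr1 snd E.
    rewrite A B C.
    have -> : modp (e11 g) = e11 (sl2_red g) by [].
    have -> : modp (e12 g) = e12 (sl2_red g) by [].
    have -> : modp (e21 g) = e21 (sl2_red g) by [].
    by rewrite g1 !eqxx.
  case/andP => /andP[/eqP a1 /eqP b0] /eqP c0.
  have ua : a \is a GRing.unit by rewrite (unitR pr_p) a1 oner_neq0.
  have E : a * (a^-1 * (1 + b * c)) - b * c = 1 by rewrite mulVKr // addrK.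
  exists (mk2 E) => //; rewrite inE; apply/eqP/sl2_eq; rewrite ?e_1 !e_mk //.
  rewrite -[LHS]mul1r -{1}a1 -modpM // mulVKr // modpD // modpM // modp1 // b0.
  by rewrite mul0r addr0.
rewrite !cardsX !(card_modp_fiber pr_p) -!expnD; congr (_ ^ _)%N.
by rewrite !mulSn mul0n addn0 addnA.
Qed.

Lemma card_sl2_red (P : pred (sl2 F)) :
  #|[set g | P (sl2_red g)]| = (p ^ (3 * n) * #|[set g | P g]|)%N.
Proof.
rewrite -sum1_card (partition_big sl2_red P) => [|g]; last by rewrite inE.
rewrite (eq_bigr (fun=> p ^ (3 * n))%N) => [|g0 Pg0]; last first.
  rewrite -(card_sl2_red_fiber g0) -sum1_card; apply: eq_bigl => g.
  by rewrite !inE; case: eqP => [->|]; rewrite ?Pg0 // andbF.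
by rewrite sum_nat_const mulnC cardsE.
Qed.

Lemma card_sl2R : #|{: sl2 R}| = (p ^ (3 * n) * #|{: sl2 F}|)%N.
Proof.
have E (T : finType) : #|[set _ : T | true]| = #|{: T}|.
  by rewrite -cardsT; apply: eq_card => x; rewrite !inE.
by rewrite -!E; exact: (card_sl2_red xpredT).
Qed.

End Reduction.

(** Makes triples over F a [finZmodType], to which the Fourier projections apply. *)
HB.instance Definition _ (V1 V2 : finZmodType) := Finite.on (V1 * V2)%type.

Section CongruenceKernel.
Variables (C : numClosedFieldType) (p n : nat).
Hypotheses (pr_p : prime p) (p2 : p <> 2%N) (n0 : (0 < n)%N).
Local Notation R := 'Z_(p ^ n.+1).
Local Notation F := 'Z_(p ^ 1).
Local Notation V := (F * F * F)%type.
Local Notation socp := (@socp p n).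

Lemma socpM (x y : F) : socp x * socp y = 0.
Proof. by rewrite (mul_socp pr_p) (modp_socp pr_p) // mul0r socp0. Qed.

(** The matrix 1 + p^n X has determinant 1 because p^(2n) = 0 for n > 0. For the same reason X |-> 1
    + p^n X is a homomorphism from the additive group of trace zero matrices over F_p. *)
Fact kelt_proof (X : V) :
  (1 + socp X.1.1) * (1 - socp X.1.1) - socp X.1.2 * socp X.2 = 1.
Proof.
rewrite socpM subr0 mulrDl mul1r mulrBr mulr1 socpM subr0.
by rewrite subrK.
Qed.
Definition kelt X : sl2 R := mk2 (kelt_proof X).

Lemma kelt0 : kelt 0 = 1%g.
Proof. by apply: sl2_eq; rewrite !(e_mk, e_1) /= !(socp0) ?addr0 ?subr0. Qed.

Lemma keltD X Y : kelt (X + Y) = (kelt X * kelt Y)%g.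
Proof.
apply: sl2_eq; rewrite !eM !e_mk /= !(socpD pr_p) ?mulrDl ?mulrDr ?mulrBl ?mulrBr
  ?mulrN ?mulNr !socpM ?mulr1 ?mul1r; ring.
Qed.

(** The factor p^n only sees g modulo p, so conjugation on the kernel is the adjoint action of the
    reduction of g. *)
Lemma kelt_conj g X : (g * kelt X = kelt (adj (sl2_red pr_p g) X) * g)%g.
Proof.
case: X => [[x y] z]; have D := sl2_det g.
pose X := socp x; pose Y := socp y; pose Z := socp z.
have H a b c : socp (modp a * x + modp b * y + modp c * z) = a * X + b * Y + c * Z.
  by rewrite !(socpD pr_p) !(mul_socp pr_p).
have E1 : e11 (kelt (adj (sl2_red pr_p g) (x, y, z))) =
    1 + ((e11 g * e22 g + e12 g * e21 g) * X - e11 g * e21 g * Y + e12 g * e22 g * Z).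
  rewrite e_mk -mulNr -H; congr (1 + socp _); rewrite /= !e_mk.
  by rewrite !(modpD pr_p, modpN pr_p, modpM pr_p); ring.
have E2 : e12 (kelt (adj (sl2_red pr_p g) (x, y, z))) =
    - (e11 g * e12 g + e11 g * e12 g) * X + e11 g * e11 g * Y - e12 g * e12 g * Z.
  rewrite e_mk -[in RHS]mulNr -H; congr (socp _); rewrite /= !e_mk.
  by rewrite !(modpD pr_p, modpN pr_p, modpM pr_p); ring.
have E3 : e21 (kelt (adj (sl2_red pr_p g) (x, y, z))) =
    (e21 g * e22 g + e21 g * e22 g) * X - e21 g * e21 g * Y + e22 g * e22 g * Z.
  rewrite e_mk -mulNr -H; congr (socp _); rewrite /= !e_mk.
  by rewrite !(modpD pr_p, modpN pr_p, modpM pr_p); ring.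
have E4 : e22 (kelt (adj (sl2_red pr_p g) (x, y, z))) =
    1 - ((e11 g * e22 g + e12 g * e21 g) * X - e11 g * e21 g * Y + e12 g * e22 g * Z).
  by rewrite -[in RHS](addKr 1 (_ + e12 g * e22 g * Z)) -E1 !e_mk; ring.
have D' := esym D.
apply: sl2_eq; rewrite ![in RHS]eM ?E1 ?E2 ?E3 ?E4 ![in LHS]eM !e_mk /= -/X -/Y -/Z.
- transitivity (e11 g + (e11 g * e22 g - e12 g * e21 g) * (e11 g * X + e12 g * Z)); last by ring.
  by rewrite D; ring.
- transitivity (e12 g + (e11 g * e22 g - e12 g * e21 g) * (e11 g * Y - e12 g * X)); last by ring.
  by rewrite D; ring.
- transitivity (e21 g + (e11 g * e22 g - e12 g * e21 g) * (e21 g * X + e22 g * Z)); last by ring.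
  by rewrite D; ring.
- transitivity (e22 g + (e11 g * e22 g - e12 g * e21 g) * (e21 g * Y - e22 g * X)); last by ring.
  by rewrite D; ring.
Qed.

Lemma kelt_upper z : kelt (0, z, 0) = upper (socp z).
Proof. by apply: sl2_eq; rewrite !e_mk /= ?socp0 ?addr0 ?subr0. Qed.

Lemma kelt_eq1 X : (kelt X == 1%g) = (X == 0).
Proof.
case: X => [[x y] z]; apply/eqP/eqP => [E|->]; last exact: kelt0.
have A : 1 + socp x = 1 := congr1 (@e11 R) E.
have B : socp y = 0 := congr1 (@e12 R) E.
have D : socp z = 0 := congr1 (@e21 R) E.
have A' : socp x = 0 by apply: (addrI 1); rewrite A addr0.
move: A' B D => /eqP; rewrite (socp_eq0 pr_p) => /eqP->.
move=> /eqP; rewrite (socp_eq0 pr_p) => /eqP->.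
by move=> /eqP; rewrite (socp_eq0 pr_p) => /eqP->.
Qed.

Variable w : C.
Hypothesis prim_w : (p ^ n.+1).-primitive_root w.
(** With this root of unity, the character of R of index y restricts to the ideal generated by p^n
    as the character of F_p of index y mod p. *)
Let zeta := w ^+ (p ^ n).

Lemma prim_zeta : (p ^ 1).-primitive_root zeta.
Proof.
have := dvdn_prim_root prim_w (dvdn_exp2l p (ltn0Sn n)).
by rewrite expn1 expnSr mulnK ?prime_gt0.
Qed.
Let N1 := pfactor_gt1 pr_p n.
Let F1 := pfactor_gt1 pr_p 0.

Lemma Zp_pair_socp (y : R) (z : F) : Zp_pair w y (socp z) = Zp_pair zeta (modp y) z.
Proof.
by rewrite /Zp_pair (mul_socp pr_p) /zeta -exprM socpE (Zp_pair_nat N1 prim_w).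
Qed.

Definition kpair (Y X : V) : C := Zp_pair zeta 1 (trform Y X).

(** Pairing with the three basis matrices gives 2 x, z and y; the factor 2 is invertible. *)
Lemma kpairP : perfect_pairing kpair.
Proof.
have pF := Zp_pairP F1 prim_zeta.
split=> [X Y|Y X X'|Y|Y H].
- by rewrite /kpair /trform; congr Zp_pair; ring.
- rewrite /kpair -(pairDr pF); congr Zp_pair; rewrite /trform /=; ring.
- rewrite /kpair -[RHS](pair0r pF 1); congr Zp_pair; rewrite /trform /=; ring.
have {}H X : trform Y X = 0.
  apply/eqP; rewrite -[trform _ _]mul1r -(mulr0 1) -(Zp_pair_eq F1 prim_zeta).
  by rewrite (pair0r pF); apply/eqP/H.
case: Y H => [[x y] z] H.
have := H (0, 0, 1); have := H (0, 1, 0); have := H (1, 0, 0).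
rewrite /trform /= !mulr0 !mulr1 !addr0 !add0r => /eqP.
by rewrite mul2_eq0 // => /eqP -> -> ->.
Qed.

Lemma kpair_upper Y z : kpair Y (0, z, 0) = Zp_pair zeta Y.2 z.
Proof.
by rewrite /kpair /trform /= !mulr0 !add0r /Zp_pair mul1r.
Qed.
End CongruenceKernel.

(** * Degrees and number of the new representations *)

Section NewRepresentations.
Variables (C : numClosedFieldType) (p n : nat).
Hypotheses (pr_p : prime p) (p2 : p <> 2%N) (n0 : (0 < n)%N).
Local Notation R := 'Z_(p ^ n.+1).
Local Notation F := 'Z_(p ^ 1).
Local Notation V := (F * F * F)%type.
Local Notation G := [set: sl2 R]%G.
Local Notation red := (sl2_red pr_p (n := n)).
Local Notation K := (kelt pr_p n0).
Variables (w : C).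
Hypothesis prim_w : (p ^ n.+1).-primitive_root w.
Let N1 := pfactor_gt1 pr_p n.
Let F1 := pfactor_gt1 pr_p 0.
Let pK := kpairP pr_p p2 prim_w.
Let pF := Zp_pairP F1 (prim_zeta pr_p prim_w).
Let pR := Zp_pairP N1 prim_w.

Section Projections.
Variables (d : nat) (r : mx_representation C G d).

Let rk : V -> 'M[C]_d := r \o K.

Let rk0 : rk 0 = 1%:M.
Proof. by rewrite /rk /= kelt0 repr_mx1. Qed.

Let rkD X Y : rk (X + Y) = rk X *m rk Y.
Proof. by rewrite /rk /= keltD repr_mulT. Qed.

Definition kproj (Y : V) : 'M[C]_d := fourier_proj (kpair n w) (r \o K) Y.

Lemma kproj_idem Y : kproj Y *m kproj Y = kproj Y.
Proof. exact: (fourier_idem pK rkD). Qed.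

Lemma kproj_orth Y Y' : kproj Y *m kproj Y' = (Y == Y')%:R *: kproj Y.
Proof. exact: (fourier_orth pK rkD). Qed.

Lemma kproj_sum : \sum_Y kproj Y = 1%:M.
Proof. exact: (fourier_sum pK rk0). Qed.

Lemma kproj_adj g Y : r g *m kproj Y = kproj (adj (red g) Y) *m r g.
Proof.
rewrite -{1}(adjK (red g) Y).
apply: (fourier_conj (phi := adj (red g)) (psi := adj (red g)^-1%g)).
- exact: (can_inj (adjK (red g))).
- exact: adjN.
- by move=> X; rewrite /= -!repr_mulT (kelt_conj pr_p n0).
by move=> X; rewrite /kpair trform_adj.
Qed.

Lemma kproj_conj g Y : r g *m kproj Y *m r g^-1%g = kproj (adj (red g) Y).
Proof. by rewrite kproj_adj -mulmxA -repr_mulT mulgV repr_mx1 mulmx1. Qed.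

Lemma kproj_trace_adj g Y : \tr (kproj (adj (red g) Y)) = \tr (kproj Y).
Proof.
by rewrite -kproj_conj mxtrace_mulC mulmxA -repr_mulT mulVg repr_mx1 mul1mx.
Qed.

Lemma kproj_trace0 Y : (\tr (kproj Y) == 0) = (kproj Y == 0).
Proof.
by rewrite (idempotent_mxtrace (kproj_idem Y)) pnatr_eq0 mxrank_eq0.
Qed.

(* Both sides are the trace of the isotypic projection on which [upper (socp z)]
   acts by the character of index [z0]. *)
Lemma kproj_whittaker (z0 : F) :
  \sum_(Y : V | Y.2 == z0) kproj Y = \sum_(y : R | modp y == z0) whittaker w r y.
Proof.
rewrite -(fourier_restrict pR pF (repr_upper0 r) (repr_upperD r) (h := @socp p n)); last first.
  exact: (Zp_pair_socp pr_p prim_w).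
rewrite -(fourier_restrict pK pF rk0 rkD (h := fun z => (0, z, 0)) (k := snd)); last first.
  exact: kpair_upper.
rewrite !fourier_projE; congr (_ *: _); apply: eq_bigr => z _.
by rewrite /= /rk /= kelt_upper.
Qed.

Hypothesis irr : mx_irreducible r.

(** The average of the conjugates of [kproj Y] is a scalar by Schur; multiplied by [kproj Y'], it
    retains only the g that carry Y to Y'. This yields Clifford's theorem that the characters form
    one orbit and, for Y' = Y, the degree. *)
Lemma kproj_transporter Y Y' : kproj Y != 0 -> kproj Y' != 0 ->
  #|[set g | adj (red g) Y == Y']|%:R = #|{: sl2 R}|%:R * \tr (kproj Y) / d%:R :> C.
Proof.
move=> nY nY'; have := schur_averageT irr (kproj Y).
rewrite (eq_bigr _ (fun g _ => kproj_conj g Y)) => /(congr1 (mulmx (kproj Y'))).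
rewrite mulmx_sumr mul_mx_scalar (eq_bigr _ (fun g _ => kproj_orth Y' _)).
rewrite -scaler_suml => /eqP; rewrite -subr_eq0 -scalerBl scaler_eq0 (negPf nY') orbF.
rewrite subr_eq0 => /eqP <-; rewrite -sum1_card natr_sum big_mkcond /=.
by apply: eq_bigr => g _; rewrite inE eq_sym; case: eqP.
Qed.

Lemma kproj_orbit Y Y' : kproj Y != 0 -> kproj Y' != 0 ->
  exists g, adj (red g) Y = Y'.
Proof.
move=> nY nY'; have E := kproj_transporter nY nY'.
have : #|[set g | adj (red g) Y == Y']| != 0%N.
  rewrite -(eqr_nat C) E mulf_neq0 ?invr_eq0 ?(irr_dim_neq0 irr) //.
  by rewrite mulf_neq0 ?kproj_trace0 // pnatr_eq0 -cardsT -lt0n cardG_gt0.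
by rewrite cards_eq0 => /finset.set0Pn[g]; rewrite inE => /eqP; exists g.
Qed.

(** The quotient y'/y is congruent to 1, hence a square t^2, and diag(t, t^-1) conjugates one
    character of U into the other. *)
Lemma whittaker_trace_const (y y' : R) : modp y != 0 -> modp y = modp y' ->
  \tr (whittaker w r y) = \tr (whittaker w r y').
Proof.
move=> y0 yy'; have uy : y \is a GRing.unit by rewrite unitR.
have [|t [t1 tt]] := sqrt_one_unit pr_p (x := y^-1 * y') p2.
  by rewrite modpM // -yy' -modpM // mulVr // modp1.
have ut : t * t^-1 = 1 by rewrite mulrV // unitR // t1 oner_neq0.
have y'E : y' = y * (t * t) by rewrite tt mulVKr.
pose g := diag2 ut.
suff E : r g *m whittaker w r y' = whittaker w r y *m r g.
  have : \tr (whittaker w r y) = \tr (whittaker w r y *m r g *m r g^-1%g).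
    by rewrite -mulmxA -repr_mulT mulgV repr_mx1 mulmx1.
  by rewrite -E mxtrace_mulC mulmxA -repr_mulT mulVg repr_mx1 mul1mx => ->.
rewrite y'E; apply: (fourier_conj (phi := fun x => t * t * x) (psi := fun y => y * (t * t))).
- have inv x : t^-1 * t^-1 * (t * t * x) = x.
    by transitivity (t * t^-1 * (t * t^-1) * x); [ring | rewrite ut !mul1r].
  by move=> x x' E; rewrite -(inv x) E inv.
- by move=> x; rewrite mulrN.
- move=> x /=; rewrite -!repr_mulT; congr (r _).
  apply: sl2_eq; rewrite !eM !e_mk; try by ring.
  by transitivity (t * x * (t * t^-1)); [rewrite ut; ring | ring].
- by move=> x; rewrite /Zp_pair mulrA.
Qed.

Lemma kproj_trace Y : Y != 0 -> kproj Y != 0 -> \tr (kproj Y) = (p ^ n.-1)%:R.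
Proof.
(* Only a nonzero lower left entry gives primitive characters of U. If it vanishes, the Weyl element
   brings the upper right entry there, and if that vanishes too, [lower 1] produces 2 x. *)
wlog z0 : Y / Y.2 != 0 => [IH|] Y0 nY.
  have [g gz] : exists g, (adj (red g) Y).2 != 0.
    case: Y Y0 {nY} => [[x y] z] Y0; have [z0|z0] := eqVneq z 0; last first.
      by exists 1%g; rewrite sl2_red1 adj1.
    have [y0|y0] := eqVneq y 0; last first.
      exists (weyl R); rewrite /= !e_mk modp1 // modp0 // z0.
      by rewrite !(mulr0, mul0r, mul1r, addr0, sub0r) oppr_eq0.
    exists (lower 1); rewrite /= !e_mk modp1 // y0 z0 !(mulr0, subr0, addr0, mul1r).
    rewrite Fp_mulf_eq0 // negb_or Fp_two_neq0 //=.
    by apply: contraNneq Y0 => x0; rewrite x0 y0 z0.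
  rewrite -(kproj_trace_adj g); apply: IH => //.
    by apply: contraNneq gz => ->.
  by rewrite -kproj_trace0 kproj_trace_adj kproj_trace0.
have uz : Y.2 \is a GRing.unit by rewrite unitFp.
have adj_upper s0 (Z : V) : (adj (red (upper s0)) Z).1.1 = Z.1.1 + modp s0 * Z.2
    /\ (adj (red (upper s0)) Z).2 = Z.2.
  case: Z => [[x y] z]; rewrite /= !e_mk modp1 // modp0 //.
  by split; ring.
have trY' Y' : Y'.2 = Y.2 ->
    \tr (kproj Y') = if negdet Y' == negdet Y then \tr (kproj Y) else 0.
  move=> z'; have [D|D] := eqVneq (negdet Y') (negdet Y); last first.
    apply/eqP; rewrite kproj_trace0; apply: contraNT D => nY'.
    by have [g <-] := kproj_orbit nY nY'; rewrite negdet_adj.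
  pose s := liftp n ((Y'.1.1 - Y.1.1) / Y.2).
  rewrite -(kproj_trace_adj (upper s) Y); congr (\tr (kproj _)).
  have D2 : negdet (adj (red (upper s)) Y) = negdet Y' by rewrite negdet_adj.
  have xE : (adj (red (upper s)) Y).1.1 = Y'.1.1.
    by rewrite (adj_upper s Y).1 liftpK // divrK // addrC subrK.
  have zE : (adj (red (upper s)) Y).2 = Y.2 := (adj_upper s Y).2.
  move: (adj _ _) xE zE D2 => Z xE zE; rewrite /negdet xE zE z' => /addrI/(mulIr uz) yE.
  by move: Z xE zE yE; rewrite -z'; case: (Y') => [[x' y'] zz'] [[x y] z] /= -> -> ->.
have sumt : \sum_(Y' : V | Y'.2 == Y.2) \tr (kproj Y') = p%:R * \tr (kproj Y).
  rewrite (eq_bigr _ (fun Y' H => trY' Y' (eqP H))) -big_mkcondr sumr_const mulr_natl.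
  congr (_ *+ _); pose f x := (x, (negdet Y - x * x) / Y.2, Y.2).
  have inj : injective f by move=> x x' [].
  rewrite -[RHS](card_Fp pr_p) -[RHS](card_imset _ inj); apply: eq_card => Z.
  apply/andP/imsetP => [[/eqP zE /eqP DE]|[x _ ->]]; last first.
    by rewrite /= /negdet /= divrK // addrC subrK !eqxx.
  rewrite -zE in uz; exists Z.1.1 => //; rewrite /f -DE -zE.
  by case: Z uz {zE DE} => [[x y] z] /= uz; rewrite /negdet /= addrC addKr mulrK.
have sumw : \sum_(y : R | modp y == Y.2) \tr (whittaker w r y)
    = (p ^ n)%:R * \tr (whittaker w r (liftp n Y.2)).
  rewrite (eq_bigr (fun=> \tr (whittaker w r (liftp n Y.2)))) => [|y /eqP yz].
    by rewrite sumr_const mulr_natl -(card_modp_fiber pr_p n Y.2) cardsE.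
  by apply: whittaker_trace_const; rewrite ?liftpK // yz.
have := congr1 mxtrace (kproj_whittaker Y.2); rewrite !raddf_sum /= sumt sumw.
rewrite (idempotent_mxtrace (whittaker_idem r pr_p prim_w _)).
have := whittaker_rank pr_p prim_w irr (y := liftp n Y.2).
rewrite liftpK // z0 => /(_ isT).
have p0 : p%:R != 0 :> C by rewrite pnatr_eq0 -lt0n prime_gt0.
(* Rank 0 would make [kproj Y] vanish; rank 1 leaves p tr = p^n. *)
case: (\rank _) => [|[|//]] _.
  by rewrite mulr0 => /eqP; rewrite mulf_eq0 (negPf p0) kproj_trace0 (negPf nY).
by rewrite mulr1 -{1}(prednK n0) expnS natrM => /(mulfI p0).
Qed.

Lemma kproj_degree Y : Y != 0 -> kproj Y != 0 ->
  (d * #|adj_stab Y| = p ^ n.-1 * #|{: sl2 F}|)%N.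
Proof.
move=> Y0 nY; have := kproj_transporter nY nY; rewrite kproj_trace //.
rewrite (card_sl2_red pr_p n (fun g => adj g Y == Y)) (card_sl2R pr_p).
rewrite -[[set g | _]]/(adj_stab Y) !natrM => E.
have dn0 := irr_dim_neq0 irr.
have q0 : (p ^ (3 * n))%:R != 0 :> C by rewrite pnatr_eq0 -lt0n expn_gt0 prime_gt0.
apply/eqP; rewrite -(eqr_nat C) !natrM; apply/eqP/(mulfI q0).
by rewrite mulrCA E; field.
Qed.

(* [kproj 0] is a central idempotent. *)
Lemma kproj_new : ~ (forall X, r (K X) = 1%:M) -> kproj 0 = 0.
Proof.
move=> new; have c g : g \in G -> kproj 0 *m r g = r g *m kproj 0.
  move=> _; rewrite kproj_adj; by rewrite adj0.
have [//|E1] := irr_central_idempotent irr c (kproj_idem 0).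
by case: new => X; apply: (fourier_trivial pK rkD E1).
Qed.

Lemma kproj_old : (forall X, r (K X) = 1%:M) -> forall Y, Y != 0 -> kproj Y = 0.
Proof.
move=> old Y Y0; have E : kproj Y = r (K 0) *m kproj Y by rewrite old mul1mx.
have K0 : kproj 0 = 1%:M.
  rewrite /kproj fourier_projE; under eq_bigr do rewrite /= old.
  rewrite -scaler_suml (eq_bigr (fun=> 1)) => [|X _]; last exact: (pair0l pK).
  by rewrite sumr_const scalerA mulVf ?scale1r // (card_finZmod_neq0 C V).
have := kproj_orth 0 Y; rewrite K0 mul1mx eq_sym (negPf Y0) scale0r //.
Qed.

Lemma kproj_trace_sum :
  \sum_(Y | Y != 0) \tr (kproj Y) = if [forall X, r (K X) == 1%:M] then 0 else d%:R.
Proof.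
case: ifP => [/forallP old|/forallP new].
  rewrite big1 // => Y Y0; rewrite kproj_old ?raddf0 // => X; exact/eqP.
have /(congr1 mxtrace) := kproj_sum; rewrite (bigD1 0) //= kproj_new.
  by rewrite add0r raddf_sum mxtrace1.
by move=> old; apply: new => X; apply/eqP.
Qed.

End Projections.

(** Orbits are never formed as sets: a sum over orbits is a sum over all Y with an additional weight
    1/|O|. *)
Definition orbit_size (Y : V) : nat := #|{: sl2 F}| %/ #|adj_stab Y|.

Lemma adj_stab_gt0 (Y : V) : (0 < #|adj_stab Y|)%N.
Proof. by apply/card_gt0P; exists 1%g; rewrite inE adj1. Qed.

Lemma orbit_size_gt0 Y : (0 < orbit_size Y)%N.
Proof.
rewrite divn_gt0 ?adj_stab_gt0 // dvdn_leq ?adj_stab_dvd //.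
by rewrite -cardsT cardG_gt0.
Qed.

Lemma orbit_sizeE Y : (orbit_size Y * #|adj_stab Y| = #|{: sl2 F}|)%N.
Proof. by rewrite divnK // adj_stab_dvd. Qed.

(** The degree of a new representation is the sum of its multiplicities over nonzero Y, which
    spreads its term over these Y. For fixed Y only one degree occurs, so only the sum of degree
    times multiplicity is needed, and the regular character supplies it. *)
Lemma sum_new_irr (sG : irrType C G) (f : nat -> C) :
  \sum_(i : sG | ~~ [forall X, irr_repr i (K X) == 1%:M]) f (irr_degree i)
    = \sum_(Y : V | Y != 0) #|{: sl2 F}|%:R * (p ^ n.-1)%:R
        / (orbit_size Y)%:R ^+ 2 * f (p ^ n.-1 * orbit_size Y)%N.
Proof.
pose t (i : sG) Y := \tr (kproj (irr_repr i) Y).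
have irr (i : sG) := socle_irr i.
have d0 (i : sG) := irr_dim_neq0 (irr i).
transitivity (\sum_(i : sG) \sum_(Y | Y != 0) t i Y * (f (irr_degree i) / (irr_degree i)%:R)).
  rewrite big_mkcond; apply: eq_bigr => i _; rewrite -mulr_suml (kproj_trace_sum (irr i)).
  by rewrite if_neg; case: ifP => _; [rewrite mul0r | rewrite mulrC divfK ?d0].
rewrite exchange_big /=; apply: eq_bigr => Y Y0.
have o0 : (orbit_size Y)%:R != 0 :> C by rewrite pnatr_eq0 -lt0n orbit_size_gt0.
have q0 : (p ^ n.-1)%:R != 0 :> C by rewrite pnatr_eq0 -lt0n expn_gt0 prime_gt0.
have G0 : #|{: sl2 R}|%:R != 0 :> C by rewrite pnatr_eq0 -cardsT -lt0n cardG_gt0.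
set D := (p ^ n.-1 * orbit_size Y)%N.
have deg i : t i Y != 0 -> irr_degree i = D.
  rewrite kproj_trace0 => nY; have := kproj_degree (irr i) Y0 nY.
  rewrite -(orbit_sizeE Y) mulnA => /eqP.
  by rewrite eqn_pmul2r ?adj_stab_gt0 // => /eqP.
have D0 : D%:R != 0 :> C by rewrite natrM mulf_neq0.
transitivity (f D / D%:R ^+ 2 * \sum_(i : sG) (irr_degree i)%:R * t i Y).
  rewrite mulr_sumr; apply: eq_bigr => i _.
  have [->|ti] := eqVneq (t i Y) 0; first by rewrite !(mulr0, mul0r).
  by rewrite (deg _ ti); field.
(* This is the trace of the projection on the regular representation; only X = 0 contributes, since
   X |-> 1 + p^n X is injective. *)
have -> : \sum_(i : sG) (irr_degree i)%:R * t i Y = #|{: V}|%:R^-1 * #|{: sl2 R}|%:R.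
  transitivity (\sum_(i : sG) #|{: V}|%:R^-1 * \sum_X kpair n w Y (- X) *
      ((irr_degree i)%:R * \tr (irr_repr i (K X)))).
    apply: eq_bigr => i _; rewrite /t /kproj fourier_projE mxtraceZ mulrCA; congr (_ * _).
    rewrite raddf_sum mulr_sumr; apply: eq_bigr => X _ /=.
    by rewrite mxtraceZ mulrCA.
  rewrite -mulr_sumr exchange_big /=; congr (_ * _).
  under eq_bigr => X _ do
    rewrite -mulr_sumr (sum_irr_trace sG (finset.in_setT _)) cardsT kelt_eq1.
  rewrite (bigD1 0) // big1 ?addr0 => [|X /negPf X0]; last by rewrite X0 !mulr0.
  by rewrite eqxx oppr0 (pair0r pK) mulr1 mul1r; exact: addr0.
have -> : #|{: V}| = (p ^ 3)%N.
  by rewrite !card_prod !(card_Fp pr_p) !expnS muln1 mulnA.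
have -> : #|{: sl2 R}|%:R = (p ^ 3)%:R * (p ^ n.-1)%:R ^+ 3 * #|{: sl2 F}|%:R :> C.
  rewrite (card_sl2R pr_p) natrM; congr (_ * _).
  by rewrite -natrX -natrM -expnM -expnD -[in LHS](prednK n0) mulnS [(3 * _)%N]mulnC.
have p3 : (p ^ 3)%:R != 0 :> C by rewrite pnatr_eq0 -lt0n expn_gt0 prime_gt0.
rewrite -(mulrA (p ^ 3)%:R) mulKf // {2}/D natrM; move: (f D) => y.
move: ((p ^ n.-1)%:R : C) ((orbit_size Y)%:R : C) q0 o0 => q o q0 o0.
by field; apply/andP.
Qed.

End NewRepresentations.

(** * Continuous representations factor through finite levels *)

Lemma cvg_initial (S : choiceType) (T : topologicalType) (f : S -> T)
    (F : set_system S) (s : S) : Filter F ->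
  (f @ F --> f s)%classic -> (F --> (s : initial_topology f))%classic.
Proof.
move=> FF fF A [_ [[B Bop <-] Bfs sBA]]; apply: filterS sBA _.
by apply: fF; apply: open_nbhs_nbhs.
Qed.

Section CongruenceTopology.
Variable (p : nat).
Local Notation S := (SL2Zp p).

Definition congr_subgroup n : set S :=
  [set g | forall i j, padic_val (SL2_mx g i j) n = padic_val ((1%:M : 'M[padic_int p]_2) i j) n].

Lemma padic_val_le (x y : padic_int p) m n : (m <= n)%N ->
  padic_val x n = padic_val y n -> padic_val x m = padic_val y m.
Proof.
elim: n => [|n IH]; first by rewrite leqn0 => /eqP->.
rewrite leq_eqVlt => /orP[/eqP->//|mn] xy; apply: IH => //.
by rewrite -(padic_valP x) -(padic_valP y) xy.
Qed.

Definition congr_filter : set_system S := filter_from setT congr_subgroup.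

Lemma congr_filter_filter : Filter congr_filter.
Proof.
apply: filter_from_filter; first by exists 0%N.
move=> m n _ _; exists (maxn m n) => // g gmn; split=> i j.
  by apply: padic_val_le (leq_maxl m n) _; apply: gmn.
by apply: padic_val_le (leq_maxr m n) _; apply: gmn.
Qed.

(** Every neighbourhood of 1 contains a congruence subgroup: this is what continuity of a
    representation is tested against. *)
Lemma congr_filter_cvg : (congr_filter --> (1%g : S))%classic.
Proof.
have FF := congr_filter_filter.
apply: (@cvg_initial S _ (@SL2_mx p)) => A [P PM sPA].
have entry i j : (fmap (fun g : S => SL2_mx g i j) congr_filter
    --> SL2_mx (1%g : S) i j)%classic.
  apply: (@cvg_initial (padic_int p)
    (prod_topology (fun n => discrete_topology 'Z_(p ^ n.+1))) (@padic_val p)).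
  apply/cvg_sup => n; apply: cvg_initial => B /nbhs_singleton Bn.
  exists n => // g gn; rewrite /= gn; exact: Bn.
have : congr_filter (fun g => forall i j, P i j (SL2_mx g i j)).
  apply: (@filter_forall S 'I_2 (fun i g => forall j, P i j (SL2_mx g i j)) _ FF) => i.
  apply: (@filter_forall S 'I_2 (fun j g => P i j (SL2_mx g i j)) _ FF) => j.
  by apply: entry; exact: PM.
by apply: filterS => g Pg; apply: sPA.
Qed.

Definition sl2_entry_const n (g : S) : set S :=
  [set h | forall i j, padic_val (SL2_mx h i j) n = padic_val (SL2_mx g i j) n].

(** Cosets of congruence subgroups are neighbourhoods, so functions that factor through a finite
    level are continuous. *)
Lemma sl2_entry_const_nbhs n (g : S) : nbhs g (sl2_entry_const n g).
Proof.
pose Q i j (h : S) := padic_val (SL2_mx h i j) n = padic_val (SL2_mx g i j) n.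
apply: (@filter_forall S 'I_2 (fun i h => forall j, Q i j h) (nbhs g) _) => i.
apply: (@filter_forall S 'I_2 (fun j h => Q i j h) (nbhs g) _) => j.
have c1 : continuous (@SL2_mx p).
  exact: (@initial_continuous S 'M[padic_int p]_2 (@SL2_mx p)).
have c2 : continuous (@padic_val p : padic_int p ->
    prod_topology (fun n => discrete_topology 'Z_(p ^ n.+1))).
  exact: initial_continuous.
have c3 := @proj_continuous nat (fun n => discrete_topology 'Z_(p ^ n.+1)) n.
have c4 : continuous (fun M : 'M[padic_int p]_2 => M i j).
  move=> M A MA.
  pose P i' j' : set (padic_int p) := if (i' == i) && (j' == j) then A else setT.
  exists P; first by move=> i' j'; rewrite /P; case: ifP => [/andP[/eqP-> /eqP->]|_] //; exact: filterT.
  by move=> N PN; have := PN i j; rewrite /P !eqxx.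
have := @discrete_set1 (discrete_topology 'Z_(p ^ n.+1)) (padic_val (SL2_mx g i j) n).
by move=> /(c3 _)/(c2 _)/(c4 _)/(c1 _).
Qed.

End CongruenceTopology.

(* If [A] is within [e] of [1] then so is its square, and
   [2 (A - 1) = (A^2 - 1) - (A - 1)^2] improves the bound on [A - 1]. *)
Lemma no_small_subgroup (R : realType) d (H : 'M[R[i]]_d -> Prop) (e : R) :
  0 <= e -> e * d%:R <= 2^-1 ->
  (forall A, H A -> H (A *m A)) ->
  (forall A, H A -> forall i j, `|(A - 1%:M) i j| <= e%:C%C) ->
  forall A, H A -> A = 1%:M.
Proof.
move=> e0 ed HM He A HA.
(* If the entries of A - 1 and A^2 - 1 are at most b, those of (A - 1)^2 are at most b e d <= b/2;
   hence twice A - 1 is at most 3 b/2, and the bound shrinks by 3/4. *)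
have bound k : forall A, H A -> forall i j, `|(A - 1%:M) i j| <= (e * (3 / 4) ^+ k)%:C%C.
  elim: k => [|k IH] {HA}A HA i j; first by rewrite expr0 mulr1; exact: He.
  set B := A - 1%:M; set b := e * (3 / 4) ^+ k.
  have BB : B *+ 2 = (A *m A - 1%:M) - B *m B.
    rewrite /B mulmxBl !mulmxBr !mulmx1 !mul1mx mulr2n; apply/matrixP => i' j'; rewrite !mxE; ring.
  have b0 : 0 <= b by rewrite mulr_ge0 // exprn_ge0 // divr_ge0.
  have be : b <= e by rewrite /b ler_piMr // exprn_ile1 ?divr_ge0 // ler_pdivrMr // mul1r ler_nat.
  have B2 : `|(B *m B) i j| <= (b * (e * d%:R))%:C%C.
    rewrite mxE; apply: le_trans (ler_norm_sum _ _ _) _.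
    have -> : (b * (e * d%:R))%:C%C = \sum_(k' < d) (b * e)%:C%C.
      by rewrite sumr_const card_ord -raddfMn /= mulrA mulr_natr.
    apply: ler_sum => k' _; rewrite normrM rmorphM ler_pM ?normr_ge0 //; first exact: IH.
    exact: He.
  have : `|(B *+ 2) i j| <= (b * (3 / 2))%:C%C.
    rewrite BB !mxE; apply: le_trans (ler_normB _ _) _.
    have -> : b * (3 / 2) = b + b * 2^-1 by field.
    rewrite raddfD lerD //; first by have := IH _ (HM _ HA) i j; rewrite !mxE.
    by move: B2; rewrite !mxE => /le_trans; apply; rewrite lecR ler_wpM2l.
  rewrite mulmxnE -[X in `|X|]mulr_natr normrM normr_nat -ler_pdivlMr ?ltr0n // => /le_trans; apply.
  have -> : (2 : R[i]) = (2 : R)%:C%C by rewrite rmorph_nat.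
  rewrite -fmorphV -rmorphM lecR exprSr /b le_eqVlt; apply/orP; left.
  by apply/eqP; field.
apply/eqP; rewrite -subr_eq0; apply/eqP/matrixP => i j; rewrite [RHS]mxE.
apply/normr0_eq0/eqP; rewrite eq_le normr_ge0 andbT.
set x := `|_|; have x0 : 0 <= x by exact: normr_ge0.
have xR : x = (complex.Re x)%:C%C by apply/esym/RRe_real/ger0_real.
rewrite xR lecR leNgt; apply/negP => rx0.
have : ((fun k => e * (3 / 4) ^+ k) @ \oo --> e * 0)%classic.
  apply: cvgMl_tmp; apply: cvg_expr.
  by rewrite ger0_norm ?divr_ge0 // ltr_pdivrMr // mul1r ltr_nat.
rewrite mulr0 => /cvgr_lt /(_ _ rx0) [k _ /(_ k (leqnn k)) /=].
rewrite ltNge => /negP; apply.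
by rewrite -lecR -xR; exact: bound.
Qed.

Section Projection.
Variables (p n : nat).
Local Notation S := (SL2Zp p).
Local Notation R := 'Z_(p ^ n.+1).

Lemma det_mx2 (T : comNzRingType) (A : 'M[T]_2) :
  \det A = A ord0 ord0 * A ord_max ord_max - A ord0 ord_max * A ord_max ord0.
Proof.
rewrite (expand_det_row _ ord0) !big_ord_recl big_ord0 /cofactor !det_mx11 !mxE /=.
rewrite addr0 expr0 expr1 mul1r mulN1r mulrN.
have -> : lift ord0 ord0 = ord_max :> 'I_2 by apply: val_inj.
by congr (_ * A _ _ - _ * A _ _); apply: val_inj.
Qed.

Lemma padic_valD (x y : padic_int p) : padic_val (x + y) n = padic_val x n + padic_val y n.
Proof. by []. Qed.
Lemma padic_valN (x : padic_int p) : padic_val (- x) n = - padic_val x n.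
Proof. by []. Qed.
Lemma padic_valM (x y : padic_int p) : padic_val (x * y) n = padic_val x n * padic_val y n.
Proof. by []. Qed.
Lemma padic_val1 : padic_val (1 : padic_int p) n = 1.
Proof. by []. Qed.
Lemma padic_val0 : padic_val (0 : padic_int p) n = 0.
Proof. by []. Qed.

Fact sl2_proj_proof (g : S) :
  padic_val (SL2_mx g ord0 ord0) n * padic_val (SL2_mx g ord_max ord_max) n
  - padic_val (SL2_mx g ord0 ord_max) n * padic_val (SL2_mx g ord_max ord0) n = 1.
Proof.
by rewrite -!padic_valM -padic_valN -padic_valD -det_mx2 SL2_det padic_val1.
Qed.
Definition sl2_proj (g : S) : sl2 R := mk2 (sl2_proj_proof g).

Lemma mulmx2E (T : comNzRingType) (A B : 'M[T]_2) i j :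
  (A *m B) i j = A i ord0 * B ord0 j + A i ord_max * B ord_max j.
Proof.
rewrite mxE !big_ord_recl big_ord0 addr0.
by have -> : lift ord0 ord0 = ord_max :> 'I_2 by apply: val_inj.
Qed.

Lemma sl2_projM g h : sl2_proj (g * h)%g = (sl2_proj g * sl2_proj h)%g.
Proof. by apply: sl2_eq; rewrite !eM !e_mk /= mulmx2E. Qed.

Lemma sl2_proj1 : sl2_proj 1%g = 1%g.
Proof. by apply: (mulgI (sl2_proj 1%g)); rewrite -sl2_projM !mulg1. Qed.

Lemma sl2_projV g : sl2_proj g^-1%g = (sl2_proj g)^-1%g.
Proof. by apply: (mulgI (sl2_proj g)); rewrite -sl2_projM !mulgV sl2_proj1. Qed.

Lemma ord2P (P : 'I_2 -> Prop) : P ord0 -> P ord_max -> forall i, P i.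
Proof.
move=> P0 P1 i; have [->//|i0] := eqVneq i ord0.
suff -> : i = ord_max by [].
by apply: val_inj; case: i i0 => [[|[|]]].
Qed.

Lemma sl2_proj_eq g h : sl2_proj g = sl2_proj h <->
  forall i j, padic_val (SL2_mx g i j) n = padic_val (SL2_mx h i j) n.
Proof.
split=> [E|E]; last by apply: sl2_eq; rewrite !e_mk E.
apply: ord2P; apply: ord2P.
- exact: (congr1 (@e11 R) E).
- exact: (congr1 (@e12 R) E).
- exact: (congr1 (@e21 R) E).
- exact: (congr1 (@e22 R) E).
Qed.

Lemma congr_subgroupP g : congr_subgroup n g <-> sl2_proj g = 1%g.
Proof. by rewrite -sl2_proj1 sl2_proj_eq. Qed.

End Projection.

(** By continuity some congruence subgroup maps into the ball of radius 1/(2 deg) around 1; its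
    image is closed under squaring, so it is trivial. *)
Lemma irrep_trivial_congr (R : realType) (p : nat) (r : irrep R p) :
  exists n, forall g, congr_subgroup n g -> r g = 1%:M.
Proof.
pose e : R := (2 * (deg r)%:R)^-1.
have d0 : 0 < (deg r)%:R :> R by rewrite ltr0n irrep_deg_gt0.
have e0 : 0 < e by rewrite invr_gt0 mulr_gt0.
have nb : nbhs (1%:M : 'M[R[i]]_(deg r))
    [set M | forall i j, `|(M - 1%:M) i j| <= e%:C%C]%classic.
  exists (fun i j => [set z | `|z - (1%:M : 'M[R[i]]_(deg r)) i j| <= e%:C%C]%classic).
    move=> i j.
    have eC : 0 < e%:C%C by rewrite ltcR.
    have := @cvgr_distC_le _ _ _ (nbhs ((1%:M : 'M[R[i]]_(deg r)) i j)) _ id _ cvg_id _ eC.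
    exact.
  by move=> N HN i j; rewrite !mxE; have := HN i j; rewrite /= !mxE.
have ct : (r x @[x --> (1%g : SL2Zp p)] --> r 1%g)%classic by exact: irrep_continuous.
have [n _ nE] : @congr_filter p [set g | forall i j, `|(r g - 1%:M) i j| <= e%:C%C]%classic.
  by rewrite irrep_mx1 in ct; apply: (@congr_filter_cvg p); exact: (ct _ nb).
exists n => g gn.
apply: (@no_small_subgroup R (deg r)
  (fun A => exists2 h, congr_subgroup n h & A = r h) e (ltW e0)); last by exists g.
- by rewrite /e invfM -mulrA mulVf ?mulr1 // lt0r_neq0.
- move=> A [h hn ->]; exists (h * h)%g; last by rewrite irrep_mxM.
  by move/congr_subgroupP: hn => h1; apply/congr_subgroupP; rewrite sl2_projM h1 mulg1.
- by move=> A [h hn ->]; exact: nE.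
Qed.

Section ProjectionSurjective.
Variables (p : nat) (pr_p : prime p).

Lemma padic_val_nat n k : padic_val (k%:R : padic_int p) n = k%:R.
Proof. by elim: k => // k IH; rewrite mulrSr padic_valD IH mulrSr. Qed.

Lemma padic_unit (x : padic_int p) : padic_val x 0 != 0 ->
  exists y, x * y = 1.
Proof.
move=> x0.
have modpx n : modp (padic_val x n) = padic_val x 0.
  elim: n => [|n IH]; first exact: modp_id.
  by rewrite -IH -(padic_valP x n) /padic_red -Zp_nat modp_nat.
have ux n : padic_val x n \is a GRing.unit by rewrite unitR // modpx.
have cy : `[< forall n, padic_red (padic_val x n.+1)^-1 = (padic_val x n)^-1 >].
  apply/asboolP => n; apply: (mulrI (ux n)); rewrite (mulrV (ux n)) -(padic_valP x n).
  by rewrite -padic_redM (mulrV (ux n.+1)); exact: padic_red1.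
exists (PadicInt cy); apply: padic_ext => n.
by rewrite padic_valM /= (mulrV (ux n)).
Qed.

Lemma sl2_proj_surj n g0 : exists g : SL2Zp p, sl2_proj n g = g0.
Proof.
have lift (g1 : sl2 'Z_(p ^ n.+1)) : modp (e11 g1) != 0 -> exists g, sl2_proj n g = g1.
  move=> a0; pose A : padic_int p := (nat_of_ord (e11 g1))%:R.
  pose B : padic_int p := (nat_of_ord (e12 g1))%:R.
  pose C : padic_int p := (nat_of_ord (e21 g1))%:R.
  have [|A' AA'] := @padic_unit A; first by rewrite /A padic_val_nat.
  pose M : 'M[padic_int p]_2 := \matrix_(i < 2, j < 2) (if i == ord0 then if j == ord0 then A else B
      else if j == ord0 then C else A' * (1 + B * C)).
  have dM : \det M == 1 by rewrite det_mx2 !mxE /= mulrA AA' mul1r addrK.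
  exists (MkSL2Zp dM).
  have EA : padic_val A n = e11 g1 by rewrite /A padic_val_nat Zp_valK.
  have EB : padic_val B n = e12 g1 by rewrite /B padic_val_nat Zp_valK.
  have EC : padic_val C n = e21 g1 by rewrite /C padic_val_nat Zp_valK.
  apply: sl2_eq; rewrite e_mk mxE //=.
  have ua : e11 g1 \is a GRing.unit by rewrite unitR.
  have : padic_val (A * (A' * (1 + B * C))) n = 1 + e12 g1 * e21 g1.
    by rewrite mulrA AA' mul1r padic_valD padic_valM EB EC.
  rewrite padic_valM EA => E; apply: (mulrI ua); rewrite E.
  by rewrite -(sl2_det g1) subrK.
have [a0|] := eqVneq (modp (e11 g0)) 0; last exact: lift.
have [|g gE] := lift (upper 1 * g0)%g.
  rewrite e11M !e_mk mul1r mul1r modpD // a0 add0r; apply: contraTneq isT => c0.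
  have := congr1 (@modp p n) (sl2_det g0).
  by rewrite modpD // modpN // !modpM // a0 c0 mul0r mulr0 subrr modp1.
have [|h hE] := lift (upper (- 1)); first by rewrite e_mk modp1.
by exists (h * g)%g; rewrite sl2_projM hE gE upperN mulKg.
Qed.

End ProjectionSurjective.

Section KernelOfReduction.
Variables (p : nat) (pr_p : prime p) (n : nat).

Lemma padic_red_eq0 (x : 'Z_(p ^ n.+2)) :
  padic_red x = 0 -> exists z, x = socp n.+1 z.
Proof.
rewrite /padic_red -Zp_nat => /eqP; rewrite (Zp_natr_eq0 (pfactor_gt1 pr_p n)).
by move/(socpP pr_p).
Qed.

Lemma padic_red_socp z : padic_red (socp n.+1 z) = 0 :> 'Z_(p ^ n.+1).
Proof.
apply/eqP; rewrite /padic_red -Zp_nat (Zp_natr_eq0 (pfactor_gt1 pr_p n)).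
by apply/(socpP pr_p); exists z.
Qed.

(** Three entries of g - 1 are read off as multiples of p^(n+1); the fourth is forced by the
    determinant. *)
Lemma sl2_proj_kernel (g : SL2Zp p) : sl2_proj n g = 1%g ->
  exists X, sl2_proj n.+1 g = kelt pr_p (ltn0Sn n) X.
Proof.
rewrite -(sl2_proj1 p n) => /sl2_proj_eq g1.
have E i j : exists z, padic_val (SL2_mx g i j) n.+1
    = padic_val ((1%:M : 'M[padic_int p]_2) i j) n.+1 + socp n.+1 z.
  have [|z zE] := @padic_red_eq0 (padic_val (SL2_mx g i j) n.+1
      - padic_val ((1%:M : 'M[padic_int p]_2) i j) n.+1).
    by rewrite padic_redD padic_redN !padic_valP g1 subrr.
  by exists z; rewrite -zE addrC subrK.
have [x xE] := E ord0 ord0; have [y yE] := E ord0 ord_max; have [z zE] := E ord_max ord0.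
have one00 : (1%:M : 'M[padic_int p]_2) ord0 ord0 = 1 by rewrite mxE.
have one01 : (1%:M : 'M[padic_int p]_2) ord0 ord_max = 0 by rewrite mxE.
have one10 : (1%:M : 'M[padic_int p]_2) ord_max ord0 = 0 by rewrite mxE.
rewrite one00 padic_val1 in xE; rewrite one01 padic_val0 add0r in yE.
rewrite one10 padic_val0 add0r in zE.
exists (x, y, z); apply: sl2_eq; rewrite !e_mk //=.
have D := sl2_det (sl2_proj n.+1 g); rewrite !e_mk xE yE zE socpM // subr0 in D.
have K1 := kelt_proof pr_p (ltn0Sn n) (x, y, z); rewrite /= socpM // subr0 in K1.
have u : 1 + socp n.+1 x \is a GRing.unit.
  by rewrite unitR // modpD // modp1 // modp_socp // addr0 oner_neq0.
by apply: (mulrI u); rewrite K1; exact: D.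
Qed.

Lemma kelt_lift X : exists2 g : SL2Zp p,
  sl2_proj n g = 1%g & sl2_proj n.+1 g = kelt pr_p (ltn0Sn n) X.
Proof.
have [g gE] := sl2_proj_surj pr_p (kelt pr_p (ltn0Sn n) X); exists g => //.
have H (x : padic_int p) : padic_val x n = padic_red (padic_val x n.+1).
  by rewrite padic_valP.
have E1 := congr1 (fun g => padic_red (e11 g)) gE.
have E2 := congr1 (fun g => padic_red (e12 g)) gE.
have E3 := congr1 (fun g => padic_red (e21 g)) gE.
have E4 := congr1 (fun g => padic_red (e22 g)) gE.
rewrite !e_mk padic_redD padic_red1 padic_red_socp addr0 in E1.
rewrite !e_mk padic_red_socp in E2.
rewrite !e_mk padic_red_socp in E3.
rewrite !e_mk padic_redD padic_redN padic_red1 padic_red_socp oppr0 addr0 in E4.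
by apply: sl2_eq; rewrite e_mk H ?E1 ?E2 ?E3 ?E4.
Qed.
End KernelOfReduction.

(** * Inflation from the finite levels *)

Section Inflation.
Variables (R : realType) (p : nat) (pr_p : prime p).
Local Notation C := R[i].
Local Notation G n := [set: sl2 'Z_(p ^ n.+1)]%G.

Section OneLevel.
Variables (n d : nat) (r : mx_representation C (G n) d).

Let rho (g : SL2Zp p) : 'M[C]_d := r (sl2_proj n g).

Lemma inflate_continuous : continuous rho.
Proof.
move=> g A /nbhs_singleton rA; apply: filterS (@sl2_entry_const_nbhs p n g).
by move=> h /sl2_proj_eq E; rewrite /= /rho E.
Qed.

Hypothesis irr : mx_irreducible r.

Lemma inflate_irreducible (U : 'M[C]_d) :
  (forall g, stablemx U (rho g)) -> U != 0 -> row_full U.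
Proof.
move=> stU; have [_ + ] := (mx_irrP r).1 irr; apply.
apply/mxmoduleP => x _; have [g <-] := sl2_proj_surj pr_p x; exact: stU.
Qed.

Definition inflate : irrep R p.
Proof.
refine (@Irrep R p d rho _ _ inflate_continuous (irr_dim_gt0 irr) inflate_irreducible).
- by rewrite /rho sl2_proj1 repr_mx1.
- by move=> g h; rewrite /rho sl2_projM repr_mulT.
Defined.

End OneLevel.

Definition irrG n : irrType C (G n) := DecSocleType (regular_repr C (G n)).

Definition level_class n (i : irrG n) : irrep_class R p :=
  \pi%qT (inflate (socle_irr i)).

Lemma irrep_class_eq (r1 r2 : irrep R p) :
  (\pi_(irrep_class R p) r1 = \pi_(irrep_class R p) r2)%qT <-> irrep_sim r1 r2.
Proof.
split=> [/eqmodP/asboolP //|H]; apply/eqmodP; exact/asboolP.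
Qed.

Lemma class_deg_pi (r : irrep R p) : class_deg (\pi_(irrep_class R p) r)%qT = deg r.
Proof.
have /irrep_class_eq[B [] //] : (\pi_(irrep_class R p) (generic_quotient.repr (\pi_(irrep_class R p) r))
  = \pi_(irrep_class R p) r)%qT by rewrite generic_quotient.reprK.
Qed.

Lemma level_class_deg n (i : irrG n) : class_deg (level_class i) = irr_degree i.
Proof. exact: class_deg_pi. Qed.

Lemma level_class_inj n : injective (@level_class n).
Proof.
move=> i j /irrep_class_eq[B [dij fB BE]].
rewrite -(irr_reprK_pchar (pchar_numG C (G n)) i) -(irr_reprK_pchar (pchar_numG C (G n)) j).
apply: (@irr_comp_rsim_pchar _ _ _ _ (pchar_numG C (G n)) _ _ (irr_repr i) (irr_repr j)).
exists B => // x _; by have [g <-] := sl2_proj_surj pr_p x; exact: BE.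
Qed.

Definition has_level n (c : irrep_class R p) :=
  forall g, sl2_proj n g = 1%g -> (generic_quotient.repr c : irrep R p) g = 1%:M.

Lemma has_level_pi n (r : irrep R p) :
  has_level n (\pi_(irrep_class R p) r)%qT <-> forall g, sl2_proj n g = 1%g -> r g = 1%:M.
Proof.
have H r1 r2 : irrep_sim r1 r2 -> (forall g, sl2_proj n g = 1%g -> r1 g = 1%:M) ->
    forall g, sl2_proj n g = 1%g -> r2 g = 1%:M.
  case=> B [d12 fB BE] H1 g g1; have := BE g; rewrite H1 // mul1mx => E.
  have full : row_full B by rewrite /row_full (eqP fB) d12.
  by apply: (row_full_inj full); rewrite -E mulmx1.
have S : irrep_sim (generic_quotient.repr (\pi_(irrep_class R p) r)%qT) r.
  by apply/irrep_class_eq; rewrite generic_quotient.reprK.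
split; first exact: H S.
exact/H/irrep_sim_sym.
Qed.

Lemma level_class_has_level n (i : irrG n) : has_level n (level_class i).
Proof. by apply/has_level_pi => g g1; rewrite /= g1 repr_mx1. Qed.

Lemma has_levelS n c : has_level n c -> has_level n.+1 c.
Proof.
move=> H g g1; apply: H; move: g1.
rewrite -(sl2_proj1 p n.+1) -(sl2_proj1 p n) => /sl2_proj_eq E; apply/sl2_proj_eq => i j.
by rewrite -(padic_valP (SL2_mx g i j)) E padic_valP.
Qed.

(** Composing with a set-theoretic section of the projection gives a representation of the finite
    group, because the original one is constant on fibres. *)
Lemma has_levelP n c : has_level n c -> exists i : irrG n, c = level_class i.
Proof.
move=> Hc; pose r : irrep R p := generic_quotient.repr c.
pose s (x : sl2 'Z_(p ^ n.+1)) := sval (cid (sl2_proj_surj pr_p x)).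
have sK x : sl2_proj n (s x) = x by rewrite /s; case: cid.
have rs g h : sl2_proj n g = sl2_proj n h -> r g = r h.
  move=> gh; have -> : g = ((g * h^-1) * h)%g by rewrite -mulgA mulVg mulg1.
  by rewrite irrep_mxM Hc ?mul1mx // sl2_projM sl2_projV gh mulgV.
have repr_s : mx_repr (G n) (fun x => r (s x)).
  split=> [|x y _ _]; first by rewrite Hc // sK.
  by rewrite -irrep_mxM; apply: rs; rewrite sl2_projM !sK.
pose q := MxRepresentation repr_s.
have irrq : mx_irreducible q.
  apply/mx_irrP; split; first exact: irrep_deg_gt0.
  move=> U /mxmoduleP modU nU; apply: (@irrep_irreducible _ _ r) => // g.
  have -> : r g = q (sl2_proj n g) by apply: rs; rewrite sK.
  by apply: modU; rewrite inE.
have [B dB fB BE] := rsim_irr_comp_pchar (irrG n) (pchar_numG C (G n)) irrq.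
exists (irr_comp (irrG n) q); rewrite -[c]generic_quotient.reprK; apply/irrep_class_eq.
exists B; split=> // g /=; rewrite -BE ?inE //; congr (_ *m _).
by apply: rs; rewrite sK.
Qed.

Lemma has_level_ex c : exists n, has_level n c.
Proof.
have [n H] := irrep_trivial_congr (generic_quotient.repr c : irrep R p).
by exists n => g /congr_subgroupP; exact: H.
Qed.

Lemma level_class_old n (i : irrG n.+1) :
  has_level n (level_class i) <-> forall X, irr_repr i (kelt pr_p (ltn0Sn n) X) = 1%:M.
Proof.
rewrite has_level_pi; split=> [H X|H g /(sl2_proj_kernel pr_p)[X gX]] /=.
  by have [g g1 <-] := kelt_lift pr_p n X; exact: H.
by rewrite gX; exact: H.
Qed.

End Inflation.

(** * Partial sums over levels *)

Section LevelSums.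
Variables (R : realType) (p : nat) (pr_p : prime p) (p2 : p <> 2%N).
Local Notation C := R[i].
Local Notation cls := (level_class pr_p (R := R)).
Local Notation V := ('Z_(p ^ 1) * 'Z_(p ^ 1) * 'Z_(p ^ 1))%type.

(** The classes of level n form an increasing sequence of finite sets that exhausts all classes;
    along it the net of partial sums can be computed. *)
Definition level_set n : {fset irrep_class R p} :=
  [fset cls i | i in (irrG R p n : finType)]%fset.

Lemma level_setP n c : c \in level_set n <-> has_level n c.
Proof.
split; first by case/imfsetP => i _ ->; exact: level_class_has_level.
by case/(has_levelP pr_p) => i ->; apply/imfsetP; exists i.
Qed.

Lemma level_set_sub m n : (m <= n)%N -> (level_set m `<=` level_set n)%fset.
Proof.
elim: n => [|n IH]; first by rewrite leqn0 => /eqP->.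
rewrite leq_eqVlt => /orP[/eqP->//|/IH mn]; apply: fsubset_trans mn _.
by apply/fsubsetP => c /level_setP/has_levelS/level_setP.
Qed.

Lemma level_set_cover (A : {fset irrep_class R p}) : exists n, (A `<=` level_set n)%fset.
Proof.
have /boolp.choice[n nP] : forall c : irrep_class R p, exists n, has_level n c.
  exact: has_level_ex.
exists (\max_(c <- A) n c)%N; apply/fsubsetP => c cA.
apply: (fsubsetP (level_set_sub (leq_bigmax_seq _ cA isT))).
exact/level_setP.
Qed.

Lemma level_sum n (g : irrep_class R p -> C) :
  \sum_(c <- level_set n) g c = \sum_(i : irrG R p n) g (cls i).
Proof.
rewrite big_imfset /=; last by move=> i j _ _; exact: level_class_inj.
by rewrite big_enum.
Qed.

Lemma level_sum0 (f : nat -> C) :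
  \sum_(c <- level_set 0) f (class_deg c) = \sum_(i : irrG R p 0) f (irr_degree i).
Proof. by rewrite level_sum; apply: eq_bigr => i _; rewrite level_class_deg. Qed.

(** The classes added are the representations of SL2(Z/p^(n+2)) nontrivial on the kernel of
    reduction modulo p^(n+1), so the exponent of p in their degree is n. *)
Lemma level_sumS n (f : nat -> C) :
  \sum_(c <- level_set n.+1) f (class_deg c) =
  \sum_(c <- level_set n) f (class_deg c) +
  \sum_(Y : V | Y != 0) #|{: sl2 'Z_(p ^ 1)}|%:R * (p ^ n)%:R
        / (orbit_size Y)%:R ^+ 2 * f (p ^ n * orbit_size Y)%N.
Proof.
have [w prim_w] := closed_prim_root C (ltnW (pfactor_gt1 pr_p n.+1)).
pose old (i : irrG R p n.+1) := [forall X, irr_repr i (kelt pr_p (ltn0Sn n) X) == 1%:M].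
have oldP i : reflect (has_level n (cls i)) (old i).
  apply: (iffP idP) => [/forallP H|/level_class_old H]; last by apply/forallP => X; apply/eqP.
  by apply/level_class_old => X; apply/eqP.
rewrite level_sum (bigID old) /=; congr (_ + _); last first.
  rewrite -(sum_new_irr pr_p p2 (ltn0Sn n) prim_w (irrG R p n.+1) f).
  by apply: eq_bigr => i _; rewrite level_class_deg.
have -> : level_set n = [fset cls i | i in (irrG R p n.+1 : finType) & old i]%fset.
  apply/fsetP => c; apply/idP/imfsetP => [/level_setP cn|[i /=]]; last first.
    by rewrite !inE /= => /oldP ci ->; apply/level_setP.
  have [i ci] := has_levelP pr_p (has_levelS cn).
  by exists i => //=; rewrite !inE /=; apply/oldP; rewrite -ci.
rewrite big_imfset /=; last by move=> i j _ _; exact: level_class_inj.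
by rewrite big_filter big_enum_cond.
Qed.

End LevelSums.

Lemma partial_sum_seq (I : choiceType) (V : zmodType) (x : I -> V) (A : {fset I}) :
  partial_sum x A = \sum_(i <- A) x i.
Proof. by rewrite /partial_sum big_seq_fsetE. Qed.

(** A finite set J containing L N lies in some later L m, so its sum differs from that over L N by
    at most the sum of norms over L m minus L N. This is at most 2 e/3 by convergence of the sums of
    norms. *)
Lemma cvg_partial_sum (R : realType) (I : choiceType) (x : I -> R[i])
    (L : nat -> {fset I}) (l a : R[i]) :
  (forall m n, (m <= n)%N -> (L m `<=` L n)%fset) ->
  (forall A, exists n, (A `<=` L n)%fset) ->
  ((fun n => \sum_(i <- L n) `|x i|) @ \oo --> a)%classic ->
  ((fun n => \sum_(i <- L n) x i) @ \oo --> l)%classic ->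
  (partial_sum x @ totally --> l)%classic.
Proof.
move=> Lmono Lcov cva cvl; have TF := @totally_filter I; apply/cvgrPdist_le => e e0.
have e30 : 0 < e / 3 by rewrite divr_gt0.
have /cvgrPdist_le /(_ _ e30) [N1 _ HN1] := cva.
have /cvgrPdist_le /(_ _ e30) [N2 _ HN2] := cvl.
pose N := maxn N1 N2.
exists (L N) => // J /= NJ; rewrite partial_sum_seq.
have [n Jn] := Lcov J.
have Jm : (J `<=` L (maxn n N))%fset.
  by apply: fsubset_trans Jn _; apply: Lmono; exact: leq_maxl.
have split (A B : {fset I}) (y : I -> R[i]) : (A `<=` B)%fset ->
    \sum_(i <- B) y i = \sum_(i <- A) y i + \sum_(i <- (B `\` A)%fset) y i.
  move=> AB; rewrite (big_fsetID _ (mem A)) /=; congr (_ + _).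
    by apply: eq_fbigl => i; rewrite !inE /= andbC; case: (boolP (i \in A)) => // /(fsubsetP AB)->.
  by apply: eq_fbigl => i; rewrite !inE /= andbC.
rewrite (split _ _ x NJ) opprD addrA.
have -> : e = e / 3 + (e / 3 + e / 3) by field.
apply: le_trans (ler_normB _ _) _; apply: lerD; first by apply: HN2; exact: leq_maxr.
apply: le_trans (ler_norm_sum _ _ _) _.
have sub : ((J `\` L N)%fset `<=` (L (maxn n N) `\` L N)%fset)%fset by exact: fsetSD.
apply: (@le_trans _ _ (\sum_(i <- (L (maxn n N) `\` L N)%fset) `|x i|)).
  rewrite (split _ _ (fun i => `|x i|) sub) lerDl.
  by apply: sumr_ge0.
have -> : \sum_(i <- (L (maxn n N) `\` L N)%fset) `|x i| =
    (a - \sum_(i <- L N) `|x i|) - (a - \sum_(i <- L (maxn n N)) `|x i|).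
  rewrite (split _ _ (fun i => `|x i|) (Lmono _ _ (leq_maxr n N))); ring.
have pos : 0 <= \sum_(i <- (L (maxn n N) `\` L N)%fset) `|x i| by apply: sumr_ge0.
rewrite -[X in X <= _]ger0_norm; last first.
  suff <- : \sum_(i <- (L (maxn n N) `\` L N)%fset) `|x i| =
    (a - \sum_(i <- L N) `|x i|) - (a - \sum_(i <- L (maxn n N)) `|x i|) by [].
  rewrite (split _ _ (fun i => `|x i|) (Lmono _ _ (leq_maxr n N))); ring.
apply: le_trans (ler_normB _ _) _; apply: lerD; apply: HN1; first exact: leq_maxl.
by apply: leq_trans (leq_maxr _ _); exact: leq_maxl.
Qed.

(** * Complex exponentials and meromorphy *)

Section ComplexExponential.
Variable R : realType.
Local Notation C := R[i].

Lemma expCD (z w : C) : expC (z + w) = expC z * expC w.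
Proof.
case: z w => [a b] [c d]; rewrite /expC /= expRD cosD sinD; apply/eqP.
rewrite eq_complex /=; apply/andP; split; apply/eqP; ring.
Qed.

Lemma expC0 : expC (0 : C) = 1.
Proof. by rewrite /expC /= expR0 cos0 sin0 mulr1 mulr0. Qed.

Lemma expC_real (a : R) : expC a%:C%C = (expR a)%:C%C.
Proof. by rewrite /expC /= cos0 sin0 mulr1 mulr0. Qed.

Lemma norm_expC (z : C) : `|expC z| = (expR (complex.Re z))%:C%C.
Proof.
rewrite normc_def /expC /= !exprMn -mulrDr cos2Dsin2 mulr1.
by rewrite sqrtr_sqr ger0_norm ?expR_ge0.
Qed.

Lemma derive_bound (f : R -> R) (c : R) (e : R) : is_derive (0 : R) (1 : R) f c -> 0 < e ->
  exists2 dl, 0 < dl & forall x, `|x| < dl -> `|f x - f 0 - c * x| <= e * `|x|.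
Proof.
move=> [df fc] e0.
have : ((fun h : R => h^-1 *: (f (h *: 1 + 0) - f 0)) @ 0^' --> c)%classic.
  by rewrite -fc; exact: df.
move=> /cvgrPdist_le /(_ _ e0) [dl /= dl0 H]; exists dl => // x xdl.
have [->|x0] := eqVneq x 0; first by rewrite subrr mulr0 subr0 !normr0 mulr0.
have := H x; rewrite /ball_ /= sub0r normrN => /(_ xdl x0).
rewrite addr0 [x *: 1]mulr1 => Hx.
have -> : f x - f 0 - c * x = - ((c - x^-1 *: (f x - f 0)) * x).
  by rewrite /GRing.scale /=; field.
by rewrite normrN normrM ler_wpM2r.
Qed.
Lemma norm_Complex_le (a b : R) : `|Complex a b| <= (`|a| + `|b|)%:C%C.
Proof.
rewrite normc_def lecR /= -[X in _ <= X]ger0_norm ?addr_ge0 // -sqrtr_sqr.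
apply: ler_wsqrtr; rewrite sqrrD !real_normK ?num_real // addrAC lerDl.
by rewrite mulrn_wge0 // mulr_ge0.
Qed.

(** The expansion exp(u) = 1 + u + o(u), from the real derivatives of exp, cos and sin at 0. *)
Lemma expC_bound (e : R) : 0 < e ->
  exists2 dl, 0 < dl & forall u : C, `|u| < dl%:C%C -> `|expC u - 1 - u| <= e%:C%C * `|u|.
Proof.
(* The factor 8 is 3 + 5: the errors of the real and imaginary parts come out as 3 e1 |u| and 5 e1
   |u|. *)
move=> e0; have [e1 [e10 e11 e1e]] : exists e1 : R, [/\ 0 < e1, e1 <= 1 & 8 * e1 <= e].
  exists (Num.min 1 (e / 8)); rewrite lt_min ltr01 divr_gt0 // ge_min lexx; split=> //.
  by rewrite mulrC -ler_pdivlMr // ge_min lexx orbT.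
have [d1 d10 H1] := derive_bound (@is_derive_expR R 0) e10.
have [d2 d20 H2] := derive_bound (is_derive_cos (0 : R)) e10.
have [d3 d30 H3] := derive_bound (is_derive_sin (0 : R)) e10.
exists (Num.min (Num.min d1 d2) (Num.min d3 e1)).
  by rewrite !lt_min d10 d20 d30 e10.
move=> [x y]; rewrite normc_def; set N := Num.sqrt _ => /=; rewrite ltcR.
rewrite !lt_min => /andP[/andP[Nd1 Nd2] /andP[Nd3 Ne1]].
have N0 : 0 <= N by exact: sqrtr_ge0.
have xN : `|x| <= N by rewrite -sqrtr_sqr ler_wsqrtr // lerDl sqr_ge0.
have yN : `|y| <= N by rewrite -sqrtr_sqr ler_wsqrtr // lerDr sqr_ge0.
have {}H1 := H1 x (le_lt_trans xN Nd1); rewrite expR0 mul1r in H1.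
have {}H2 := H2 y (le_lt_trans yN Nd2); rewrite cos0 sin0 oppr0 mul0r subr0 in H2.
have {}H3 := H3 y (le_lt_trans yN Nd3); rewrite sin0 cos0 mul1r subr0 in H3.
have cos1 : `|cos y| <= 1 by rewrite ler_norml cos_geN1 cos_le1.
have x1 : `|1 + x| <= 2.
  apply: le_trans (ler_normD _ _) _; rewrite normr1 -[2]/(1 + 1) lerD2l.
  exact: le_trans xN (le_trans (ltW Ne1) e11).
have e1N a : a <= N -> e1 * a <= e1 * N by move=> aN; rewrite ler_wpM2l // ltW.
have re : `|expR x * cos y - 1 - x| <= 3 * (e1 * N).
  have -> : expR x * cos y - 1 - x = (expR x - 1 - x) * cos y + (1 + x) * (cos y - 1) by ring.
  apply: le_trans (ler_normD _ _) _.
  have -> : 3 * (e1 * N) = (e1 * N) * 1 + 2 * (e1 * N) by ring.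
  rewrite !normrM; apply: lerD; apply: ler_pM => //.
    exact: le_trans H1 (e1N _ xN).
  exact: le_trans H2 (e1N _ yN).
have ex1 : `|expR x - 1| <= 2 * e1.
  have -> : expR x - 1 = (expR x - 1 - x) + x by ring.
  apply: le_trans (ler_normD _ _) _; rewrite mulr_natl mulr2n; apply: lerD.
    apply: le_trans H1 _; rewrite -[X in _ <= X]mulr1 ler_wpM2l ?(ltW e10) //.
    exact: le_trans xN (le_trans (ltW Ne1) e11).
  exact: le_trans xN (ltW Ne1).
have sy : `|sin y| <= 2 * N.
  have -> : sin y = (sin y - y) + y by ring.
  apply: le_trans (ler_normD _ _) _; rewrite mulr_natl mulr2n; apply: lerD => //.
  apply: le_trans H3 (le_trans (e1N _ yN) _).
  by rewrite -[X in _ <= X]mul1r ler_wpM2r.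
have im : `|expR x * sin y - y| <= 5 * (e1 * N).
  have -> : expR x * sin y - y = (expR x - 1) * sin y + (sin y - y) by ring.
  apply: le_trans (ler_normD _ _) _.
  have -> : 5 * (e1 * N) = (2 * e1) * (2 * N) + e1 * N by ring.
  apply: lerD; last exact: le_trans H3 (e1N _ yN).
  by rewrite normrM; apply: ler_pM.
have -> : expC (Complex x y) - 1 - Complex x y
    = Complex (expR x * cos y - 1 - x) (expR x * sin y - y).
  by apply/eqP; rewrite eq_complex /= subr0 !eqxx.
apply: le_trans (norm_Complex_le _ _) _; rewrite -rmorphM lecR.
apply: le_trans (lerD re im) _; rewrite -mulrDl mulrA ler_wpM2r //.
by apply: le_trans e1e; rewrite le_eqVlt; apply/orP; left; apply/eqP; ring.
Qed.

Lemma ger0_complexE (z : C) : 0 <= z -> z = (complex.Re z)%:C%C.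
Proof. by move=> z0; apply/esym/RRe_real/ger0_real. Qed.

Lemma expC_difference_quotient (a s : C) :
  ((fun h : C => h^-1 * (expC (a * (h + s)) - expC (a * s))) @ 0^'
    --> a * expC (a * s))%classic.
Proof.
apply/cvgrPdist_le => e e0; have eE := ger0_complexE (ltW e0).
rewrite eE ltcR in e0; rewrite eE; move: (complex.Re e) e0 => {eE}e e0.
have [M M0 ME] : exists2 M : R, 0 <= M & `|expC (a * s)| * `|a| = M%:C%C.
  exists (complex.Re (`|expC (a * s)| * `|a|)); last by apply: ger0_complexE; rewrite mulr_ge0.
  by rewrite -lecR -ger0_complexE mulr_ge0.
have [N N0 NE] : exists2 N : R, 0 <= N & `|a| = N%:C%C.
  exists (complex.Re `|a|); last exact: ger0_complexE.
  by rewrite -lecR -ger0_complexE // normr_ge0.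
(* The error at 0 is multiplied by M = |exp(a s)| |a|; the added 1 guards against M = 0. *)
have e'0 : 0 < e / (M + 1) by rewrite divr_gt0 // ltr_wpDl.
have [dl dl0 H] := expC_bound e'0.
have dl'0 : 0 < (dl / (N + 1))%:C%C by rewrite ltcR divr_gt0 // ltr_wpDl.
exists (dl / (N + 1))%:C%C => // h; rewrite /= /ball_ /= sub0r normrN => hd h0.
have ahd : `|a * h| < dl%:C%C.
  rewrite normrM NE; apply: (@le_lt_trans _ _ ((N + 1)%:C%C * `|h|)).
    by rewrite ler_wpM2r // lecR lerDl.
  by rewrite mulrC -ltr_pdivlMr ?ltcR ?ltr_wpDl // -fmorphV -rmorphM.
have -> : a * expC (a * s) - h^-1 * (expC (a * (h + s)) - expC (a * s))
    = - (expC (a * s) * (h^-1 * (expC (a * h) - 1 - a * h))).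
  by rewrite [a * (h + s)]mulrDr expCD; field.
rewrite normrN !normrM.
apply: (@le_trans _ _ (`|expC (a * s)| * (`|h^-1| * ((e / (M + 1))%:C%C * `|a * h|)))).
  by rewrite ler_wpM2l // ler_wpM2l // H.
rewrite [X in X <= _](_ : _ = (`|expC (a * s)| * `|a|) * (e / (M + 1))%:C%C * (`|h^-1| * `|h|)).
  have hh : `|h^-1| * `|h| = 1 by rewrite -normrM mulVf // normr1.
  rewrite hh mulr1 ME -rmorphM lecR.
  by rewrite mulrA ler_pdivrMr ?ltr_wpDl // mulrC ler_wpM2l ?(ltW e0) // lerDl.
by rewrite normrM; ring.
Qed.

Lemma derivable_expC (a s : C) : derivable (fun s => expC (a * s)) s 1.
Proof.
apply/cvg_ex; exists (a * expC (a * s)).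
have E : (fun h : C => h^-1 *: (expC (a * (h *: 1 + s)) - expC (a * s)))
    = (fun h : C => h^-1 * (expC (a * (h + s)) - expC (a * s))).
  by apply/funext => h; rewrite [h *: 1]mulr1.
by move: (@expC_difference_quotient a s); rewrite -E; exact.
Qed.

Lemma dirichlet_termE n (s : C) : dirichlet_term n s = expC (- (ln (n%:R : R))%:C%C * s).
Proof. by rewrite /dirichlet_term mulNr mulrC. Qed.

Lemma derivable_dirichlet_term n (s : C) : derivable (dirichlet_term n) s 1.
Proof.
have -> : dirichlet_term n = (fun s : C => expC (- (ln (n%:R : R))%:C%C * s)).
  by apply/funext => z; exact: dirichlet_termE.
exact: derivable_expC.
Qed.

Lemma dirichlet_termM m n (s : C) : (0 < m)%N -> (0 < n)%N ->
  dirichlet_term (m * n) s = dirichlet_term m s * dirichlet_term n s.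
Proof.
move=> m0 n0; rewrite !dirichlet_termE natrM lnM ?posrE ?ltr0n //.
by rewrite rmorphD opprD mulrDl expCD.
Qed.

Lemma dirichlet_term1 (s : C) : dirichlet_term 1 s = 1.
Proof. by rewrite dirichlet_termE ln1 oppr0 mul0r expC0. Qed.

Lemma dirichlet_termX m k (s : C) : (0 < m)%N ->
  dirichlet_term (m ^ k) s = dirichlet_term m s ^+ k.
Proof.
move=> m0; elim: k => [|k IH]; first by rewrite expn0 dirichlet_term1.
by rewrite expnS dirichlet_termM ?expn_gt0 ?m0 // IH exprS.
Qed.

Lemma norm_dirichlet_term n (s : C) :
  `|dirichlet_term n s| = dirichlet_term n (complex.Re s)%:C%C.
Proof.
rewrite !dirichlet_termE norm_expC -raddfN -rmorphM expC_real.
by case: s => a b /=; rewrite mul0r subr0.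
Qed.

Lemma dirichlet_term_opp n k : (0 < n)%N ->
  dirichlet_term n (- k%:R) = (n%:R ^+ k : C).
Proof.
move=> n0; rewrite dirichlet_termE mulNr mulrN opprK.
have -> : (k%:R : C) = (k%:R)%:C%C by rewrite rmorph_nat.
by rewrite -rmorphM expC_real expRM_natr lnK ?posrE ?ltr0n // rmorphXn /= rmorph_nat.
Qed.

End ComplexExponential.

Section Quotient.
Variable R : realType.
Local Notation C := R[i].
Variables A B D : C -> C.
Hypotheses (dA : forall z, derivable A z 1) (dB : forall z, derivable B z 1)
  (dD : forall z, derivable D z 1).

Lemma derivable_continuousC (f : C -> C) z : derivable f z 1 -> {for z, continuous f}.
Proof. by move=> /derivable1_diffP/differentiable_continuous. Qed.

Lemma derivable_quotient z : D z != 0 -> derivable (fun w => A w + B w / D w) z 1.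
Proof.
move=> Dz; apply: (@derivableD _ _ _ A (fun w => B w / D w)); first exact: dA.
by apply: (@derivableM _ _ B (fun w => (D w)^-1)); [exact: dB | exact: derivableV].
Qed.

Lemma holomorphic_quotient z : D z != 0 -> holomorphic_at (fun w => A w + B w / D w) z.
Proof.
move=> Dz; have cD := derivable_continuousC (@dD z).
have nD : \forall w \near z, D w != 0 by exact: cvgr_neq0 cD Dz.
by apply: filterS nD => w; exact: derivable_quotient.
Qed.

Hypothesis simple : forall z, D z = 0 -> exists2 c, c != 0 &
  ((fun h => h^-1 * D (h + z)) @ 0^' --> c)%classic.

(* At a zero of [D] take [k = 2]: the junk value [0] of [(w - z) ^+ 2 / D w] at
   [z] is then the right one, and its derivative there is [1 / D'(z)]. *)
Lemma meromorphic_quotient : meromorphic (fun w => A w + B w / D w).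
Proof.
move=> z; have [Dz|Dz] := eqVneq (D z) 0; last first.
  exists 0%N, (fun w => A w + B w / D w); split; first exact: holomorphic_quotient.
  by apply: filterS (@filterT _ (z^')%classic _) => w _; rewrite expr0 divr1.
have [c c0 cD] := simple Dz.
have [e /= e0 He] : (\forall h \near 0^', h^-1 * D (h + z) != 0)%classic.
  by exact: cvgr_neq0 cD c0.
have Dw w : `|w - z| < e -> w != z -> D w != 0.
  move=> we wz; have := He (w - z); rewrite /ball_ /= sub0r normrN we subr_eq0.
  move=> /(_ isT wz); rewrite subrK.
  by apply: contraNneq => ->; rewrite mulr0.
pose k (w : C) := (w - z) * (w - z).
have dk w : derivable k w 1.
  have dl : derivable (fun w : C => w - z) w 1.
    by apply: (@derivableB _ _ _ id (cst z)); [exact: derivable_id | exact: derivable_cst].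
  exact: (@derivableM _ _ (fun w : C => w - z) (fun w : C => w - z)).
pose h w := B w * (k w / D w).
have dh w : `|w - z| < e -> derivable h w 1.
  move=> we; have [->|wz] := eqVneq w z; last first.
    apply: (@derivableM _ _ B (fun w => k w / D w)); first exact: dB.
    apply: (@derivableM _ _ k (fun w => (D w)^-1)); first exact: dk.
    by apply: derivableV; [exact: Dw | exact: dD].
  (* As h(z) = 0, the difference quotient of h at z is B(t + z) divided by D(t + z)/t, which tends
     to B(z)/c. *)
  apply/cvg_ex; exists (B z * c^-1).
  have cB : ((fun t : C => B (t + z)) @ 0^' --> B z)%classic.
    have cBz := derivable_continuousC (@dB z).
    move=> P /cBz [e1 /= e10 H]; exists e1 => // t; rewrite /ball_ /= sub0r normrN => te _.
    by apply: H; rewrite /ball_ /= opprD addrCA subrr addr0 normrN.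
  have F0 : Filter (0^' : set_system C)%classic by exact: dnbhs_filter.
  have cV : ((fun t : C => (t^-1 * D (t + z))^-1) @ 0^' --> c^-1)%classic.
    exact: (@cvgV C C (0^')%classic _ (fun t => t^-1 * D (t + z)) c c0 cD).
  have cBV : ((fun t : C => B (t + z) * (t^-1 * D (t + z))^-1) @ 0^' --> B z * c^-1)%classic.
    exact: (@cvgM C C (0^')%classic _ (fun t => B (t + z)) _ _ _ cB cV).
  apply: cvg_trans cBV; apply: near_eq_cvg.
  exists 1; [exact: ltr01|] => t _ t0; rewrite /h /k /= [t *: 1]mulr1 subrr !mul0r mulr0 subr0 addrK.
  rewrite -[RHS]/(t^-1 * (B (t + z) * (t * t / D (t + z)))) invfM invrK.
  transitivity (B (t + z) * ((t^-1 * t) * t * (D (t + z))^-1)); last by ring.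
  by rewrite mulVf // mul1r.
exists 2%N, (fun w => A w * k w + h w); split.
  exists e; [exact: e0|] => w; rewrite /ball_ /= distrC => we.
  have d1 : derivable (fun w => A w * k w) w 1.
    by apply: (@derivableM _ _ A k); [exact: dA | exact: dk].
  exact: (@derivableD _ _ _ (fun w => A w * k w) h w 1 d1 (dh w we)).
exists e; [exact: e0|] => w; rewrite /ball_ /= distrC => we wz.
have wz0 : w - z != 0 by rewrite subr_eq0.
have Dw0 := Dw w we wz.
have -> : A w * k w + h w = (A w + B w / D w) * (w - z) ^+ 2.
  by rewrite mulrDl expr2 /h /k; congr (_ + _); rewrite mulrA mulrAC.
by rewrite mulfK // expf_neq0.
Qed.
End Quotient.

(** * The zeta function *)

Lemma cvg_exprC (R : realType) (q : R[i]) : `|q| < 1 ->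
  ((fun n => q ^+ n) @ \oo --> (0 : R[i]))%classic.
Proof.
move=> q1; have qE := ger0_complexE (normr_ge0 q).
move: (complex.Re `|q|) qE => t qE; rewrite qE ltcR in q1.
have t0 : 0 <= t by rewrite -lecR -qE; exact: normr_ge0.
apply/cvgrPdist_le => e e0; have eE := ger0_complexE (ltW e0).
rewrite eE ltcR in e0; rewrite eE; move: (complex.Re e) e0 => {eE}e e0.
have : ((fun n => t ^+ n) @ \oo --> (0 : R))%classic.
  by apply: cvg_expr; rewrite ger0_norm.
move=> /cvgrPdist_le /(_ _ e0); apply: filterS => n.
by rewrite !sub0r !normrN !normrX qE -rmorphXn /= lecR ger0_norm.
Qed.

Lemma cvg_geometricC (R : realType) (a b q : R[i]) : `|q| < 1 ->
  ((fun n => a + b * \sum_(k < n) q ^+ k) @ \oo --> a + b / (1 - q))%classic.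
Proof.
move=> q1; have q0 : 1 - q != 0.
  by rewrite subr_eq0; apply: contraTneq q1 => <-; rewrite normr1 ltxx.
have E n : a + b * \sum_(k < n) q ^+ k = (a + b / (1 - q)) + (- (b / (1 - q))) * q ^+ n.
  have -> : \sum_(k < n) q ^+ k = (1 - q ^+ n) / (1 - q).
    by rewrite -[1 - q ^+ n]opprB subrX1 -mulNr opprB mulrC mulKf.
  by field.
rewrite (_ : (fun n => _) = (fun n => (a + b / (1 - q)) + (- (b / (1 - q))) * q ^+ n)); last first.
  by apply/funext => n; exact: E.
have c1 : ((fun n => (- (b / (1 - q))) * q ^+ n) @ \oo --> (- (b / (1 - q))) * 0)%classic.
  exact: (cvgMl_tmp (cvg_exprC q1)).
apply/cvgrPdist_le => e e0; move/cvgrPdist_le: c1 => /(_ e e0); apply: filterS => n.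
by rewrite mulr0 sub0r opprD addrA subrr sub0r.
Qed.

Lemma derivable_bigsum (R : realType) (I : Type) (r : seq I) (P : pred I)
    (f : I -> R[i] -> R[i]) z : (forall i, derivable (f i) z 1) ->
  derivable (fun s => \sum_(i <- r | P i) f i s) z 1.
Proof.
move=> df; elim: r => [|i r IH].
  have -> : (fun s => \sum_(i <- [::] | P i) f i s) = cst 0.
    by apply/funext => s; rewrite big_nil.
  exact: derivable_cst.
have -> : (fun s => \sum_(j <- i :: r | P j) f j s)
    = (fun s => (if P i then f i s else 0) + \sum_(j <- r | P j) f j s).
  by apply/funext => s; rewrite big_cons; case: ifP => // _; rewrite add0r.
have di : derivable (fun s => if P i then f i s else 0) z 1.
  by case: (P i); [exact: df | exact: derivable_cst].
exact: (@derivableD _ _ _ (fun s => if P i then f i s else 0) _ z 1 di IH).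
Qed.

Section WittenZeta.
Variables (R : realType) (p : nat) (pr_p : prime p) (p2 : p <> 2%N).
Local Notation C := R[i].
Local Notation F := 'Z_(p ^ 1).
Local Notation V := (F * F * F)%type.
Local Notation m := (@orbit_size p).

Definition zeta_level0 (s : C) : C :=
  \sum_(i : irrG R p 0) dirichlet_term (irr_degree i) s.

(** The weight is 1/|O|^2 and not 1/|O| because the sum over Y meets each orbit |O| times. *)
Definition zeta_new (s : C) : C :=
  \sum_(Y : V | Y != 0) #|{: sl2 F}|%:R / (m Y)%:R ^+ 2 * dirichlet_term (m Y) s.

Definition zeta_ratio (s : C) : C := p%:R * dirichlet_term p s.

Definition zeta (s : C) : C := zeta_level0 s + zeta_new s / (1 - zeta_ratio s).

Let m0 Y : (0 < m Y)%N. Proof. exact: orbit_size_gt0. Qed.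

Lemma level_sum_dirichlet n s :
  \sum_(c <- level_set R pr_p n) dirichlet_term (class_deg c) s
    = zeta_level0 s + zeta_new s * \sum_(k < n) zeta_ratio s ^+ k.
Proof.
elim: n => [|n IH].
  by rewrite (level_sum0 pr_p (fun d => dirichlet_term d s)) big_ord0 mulr0 addr0.
rewrite (level_sumS pr_p p2 n (fun d => dirichlet_term d s)) IH.
rewrite big_ord_recr /= mulrDr addrA; congr (_ + _).
rewrite mulr_suml; apply: eq_bigr => Y _.
have pn0 : (0 < p ^ n)%N by rewrite expn_gt0 prime_gt0.
rewrite (dirichlet_termM s pn0 (m0 Y)) (dirichlet_termX n s (prime_gt0 pr_p)).
by rewrite /zeta_ratio exprMn natrX; ring.
Qed.

Lemma norm_zeta_ratio s : 1 < complex.Re s -> `|zeta_ratio s| < 1.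
Proof.
move=> s1; have p0 : 0 < p%:R :> R by rewrite ltr0n prime_gt0.
have p1 : 1 < p%:R :> R by rewrite ltr1n prime_gt1.
rewrite normrM normr_nat norm_dirichlet_term dirichlet_termE -raddfN -rmorphM expC_real.
have -> : p%:R = (p%:R)%:C%C :> C by rewrite rmorph_nat.
rewrite -rmorphM ltcR /= -{1}(lnK (_ : p%:R \is Num.pos)) ?posrE //.
rewrite -expRD -[X in _ < X]expR0 ltr_expR mulNr -[X in X - _]mulr1 -mulrBr.
by rewrite (pmulr_rlt0 _ (ln_gt0 p1)) subr_lt0.
Qed.

(** The norm of a term at s is the term at Re s, so the sums of norms are again geometric and tend
    to the value at Re s. *)
Lemma zeta_cvg s : 1 < complex.Re s ->
  (partial_sum (fun c : irrep_class R p => dirichlet_term (class_deg c) s)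
    @ totally --> zeta s)%classic.
Proof.
move=> s1; apply: (@cvg_partial_sum R _ _ (level_set R pr_p) _ (zeta (complex.Re s)%:C%C)).
- by move=> k l kl; exact: level_set_sub.
- exact: level_set_cover.
- rewrite (_ : (fun n => _) = (fun n => zeta_level0 (complex.Re s)%:C%C
      + zeta_new (complex.Re s)%:C%C * \sum_(k < n) zeta_ratio (complex.Re s)%:C%C ^+ k)).
    by apply: cvg_geometricC; exact: norm_zeta_ratio.
  apply/funext => n; rewrite -level_sum_dirichlet; apply: eq_bigr => c _.
  exact: norm_dirichlet_term.
rewrite (_ : (fun n => _) = (fun n => zeta_level0 s
    + zeta_new s * \sum_(k < n) zeta_ratio s ^+ k)).
  by apply: cvg_geometricC; exact: norm_zeta_ratio.
by apply/funext => n; rewrite -level_sum_dirichlet.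
Qed.

Lemma derivable_zeta_level0 z : derivable zeta_level0 z 1.
Proof. by apply: derivable_bigsum => i; exact: derivable_dirichlet_term. Qed.

Lemma derivable_scaled_dirichlet (c : C) n z : derivable (fun s => c * dirichlet_term n s) z 1.
Proof.
have dc : derivable (cst c : C -> C) z 1 by exact: derivable_cst.
by apply: (@derivableM _ _ (cst c) (dirichlet_term n)); [exact: dc | exact: derivable_dirichlet_term].
Qed.

Lemma derivable_zeta_new z : derivable zeta_new z 1.
Proof. by apply: derivable_bigsum => Y; exact: derivable_scaled_dirichlet. Qed.

Lemma derivable_zeta_denom z : derivable (fun s => 1 - zeta_ratio s) z 1.
Proof.
have dc : derivable (cst 1 : C -> C) z 1 by exact: derivable_cst.
have dq : derivable zeta_ratio z 1 by exact: derivable_scaled_dirichlet.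
exact: (@derivableB _ _ _ (cst 1 : C -> C) zeta_ratio z 1 dc dq).
Qed.

(** The derivative of 1 - p^(1-s) is log(p) p^(1-s), which at a zero equals log p. *)
Lemma zeta_denom_simple z : 1 - zeta_ratio z = 0 -> exists2 c : C, c != 0 &
  ((fun h => h^-1 * (1 - zeta_ratio (h + z))) @ 0^' --> c)%classic.
Proof.
move=> Dz; pose a : C := - (ln (p%:R : R))%:C%C.
have qE s : zeta_ratio s = p%:R * expC (a * s) by rewrite /zeta_ratio dirichlet_termE.
have FF : Filter (0^' : set_system C)%classic by exact: dnbhs_filter.
exists (- p%:R * (a * expC (a * z))).
  have -> : - p%:R * (a * expC (a * z)) = - a * zeta_ratio z by rewrite qE; ring.
  move/eqP: Dz; rewrite subr_eq0 => /eqP <-; rewrite mulr1 opprK eq_complex /= eqxx andbT.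
  by rewrite gt_eqF // ln_gt0 // ltr1n prime_gt1.
have := @cvgMl_tmp C C (0^')%classic FF _ (- p%:R) _ (@expC_difference_quotient R a z).
apply: cvg_trans; apply: near_eq_cvg; exists 1; [exact: ltr01|] => h _ h0 /=.
rewrite -[1 - _](subr0) -Dz !qE; ring.
Qed.

Lemma zeta_meromorphic : meromorphic zeta.
Proof.
exact: (meromorphic_quotient derivable_zeta_level0 derivable_zeta_new
  derivable_zeta_denom zeta_denom_simple).
Qed.

Lemma zeta_denom_opp k : 1 - zeta_ratio (- k.+1%:R) = 1 - p%:R ^+ k.+2 :> C.
Proof. by rewrite /zeta_ratio dirichlet_term_opp ?prime_gt0 // -exprS. Qed.

Lemma zeta_denom_opp_neq0 k : 1 - zeta_ratio (- k.+1%:R) != 0.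
Proof.
rewrite zeta_denom_opp subr_eq0 eq_sym -natrX -[1]/(1%:R) eqr_nat.
by rewrite -(exp1n k.+2) eqn_exp2r // neq_ltn prime_gt1 // orbT.
Qed.

Lemma zeta_holomorphic k : holomorphic_at zeta (- k.+1%:R).
Proof.
exact: (holomorphic_quotient derivable_zeta_level0 derivable_zeta_new
  derivable_zeta_denom (zeta_denom_opp_neq0 k)).
Qed.

Let gF : C := #|{: sl2 F}|%:R.
Let gFE : gF = p%:R ^+ 3 - p%:R.
Proof. by rewrite -natrX -(card_SL2Fp pr_p) natrD addrK. Qed.

Lemma zeta_opp1 : zeta (- 1) = 0.
Proof.
have D0 := zeta_denom_opp_neq0 0; rewrite zeta_denom_opp in D0.
rewrite /zeta (zeta_denom_opp 0).
have -> : zeta_level0 (- 1) = p%:R ^+ 2 + p%:R.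
  rewrite -natrX -natrD -(sum_irr_degree_SL2Fp pr_p (irrG R p 0) p2) natr_sum.
  apply: eq_bigr => i _; rewrite (dirichlet_term_opp _ 1) ?expr1 //.
  exact: irr_degree_gt0.
(* At s = -1 a matrix Y contributes |G_0|/|O|, the order of its stabiliser, which makes the Burnside
   count applicable. *)
have -> : zeta_new (- 1) = \sum_(Y : V | Y != 0) #|adj_stab Y|%:R.
  apply: eq_bigr => Y _; rewrite (dirichlet_term_opp _ 1) // expr1.
  have mY : (m Y)%:R != 0 :> C by rewrite pnatr_eq0 -lt0n.
  by rewrite -(orbit_sizeE Y) natrM; field.
have S : \sum_(Y : V) #|adj_stab Y|%:R + 2%:R * p%:R = 2%:R * p%:R ^+ 3 + gF * p%:R :> C.
  by rewrite -natr_sum -!natrM -natrD (sum_adj_stab pr_p p2) natrD !(natrM _ 2) natrX natrM.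
rewrite (bigD1 0) //= gFE in S.
have E0 : #|adj_stab (0 : V)|%:R = gF.
  by rewrite /gF -cardsT; congr (_%:R); apply: eq_card => g; rewrite !inE adj0 eqxx.
rewrite E0 gFE in S.
have -> : \sum_(Y : V | Y != 0) #|adj_stab Y|%:R
    = (2 * p%:R ^+ 3 + (p%:R ^+ 3 - p%:R) * p%:R) - 2 * p%:R - (p%:R ^+ 3 - p%:R) :> C.
  by rewrite -S; ring.
by field.
Qed.

Lemma zeta_opp2 : zeta (- 2%:R) = 0.
Proof.
have D0 := zeta_denom_opp_neq0 1; rewrite zeta_denom_opp in D0.
rewrite /zeta (zeta_denom_opp 1).
(* The sum of the squares of the degrees is the regular character at 1. *)
have -> : zeta_level0 (- 2%:R) = gF.
  rewrite /gF -[RHS]mulr1 -[1]/(true%:R) -(eqxx (1%g : sl2 F)) -cardsT.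
  rewrite -(sum_irr_trace (irrG R p 0) (group1 _)).
  apply: eq_bigr => i _; rewrite repr_mx1 mxtrace1 -expr2 dirichlet_term_opp //.
  exact: irr_degree_gt0.
(* The factor |O|^2 cancels the weight, so each of the p^3 - 1 nonzero Y contributes |G_0|. *)
have -> : zeta_new (- 2%:R) = \sum_(Y : V | Y != 0) gF.
  apply: eq_bigr => Y _; rewrite dirichlet_term_opp //.
  by rewrite divfK // expf_neq0 // pnatr_eq0 -lt0n.
rewrite sumr_const.
have -> : #|[pred Y : V | Y != 0]| = (p ^ 3).-1.
  by rewrite cardC1 !card_prod !(card_Fp pr_p) !expnS muln1 mulnA.
have -> : gF *+ (p ^ 3).-1 = gF * (p%:R ^+ 3 - 1).
  have p3 : (0 < p ^ 3)%N by rewrite expn_gt0 prime_gt0.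
  by rewrite -[LHS]mulr_natr; congr (_ * _); apply: (addIr 1); rewrite subrK natr1 prednK // natrX.
by field.
Qed.

End WittenZeta.

Theorem theorem4 (R : realType) (p : nat) (hp : prime p) (hp2 : p <> 2%N) :
  exists zeta : R[i] -> R[i],
    witten_zeta_continuation p zeta /\
    (holomorphic_at zeta (- 1) /\ zeta (- 1) = 0) /\
    (holomorphic_at zeta (- 2%:R) /\ zeta (- 2%:R) = 0).
Proof.
exists (@zeta R p); split; first by split; [exact: zeta_meromorphic | exists 1; exact: zeta_cvg].
split; split; [exact: (zeta_holomorphic R hp 0) | exact: zeta_opp1
  | exact: (zeta_holomorphic R hp 1) | exact: zeta_opp2].
Qed.
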